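(* Let $K$ be a constructive field. There is an algorithm which, given a polynomial $f(x,y,z)\in K\langle x,y,z\rangle$, decides whether $f$ is a $z$-tame coordinate of $K\langle x,y,z\rangle$.
   Context: A field $K$ is constructive if its elements can be effectively represented so that the field operations and equality are computable. $K\langle x,y,z\rangle$ is the free associative (unital) $K$-algebra freely generated by $x,y,z$. A $z$-automorphism is a $K$-algebra automorphism $\varphi$ of $K\langle x,y,z\rangle$ with $\varphi(z)=z$; it is written $\varphi=(f,g)$ with $f=\varphi(x)$, $g=\varphi(y)$. The $z$-affine automorphisms are those of the form $(\alpha_{11}x+\alpha_{21}y+\alpha_{31}z+\beta_1,\ \alpha_{12}x+\alpha_{22}y+\alpha_{32}z+\beta_2)$ with $\alpha_{ij},\beta_j\in K$ and the $2\times 2$ matrix $(\alpha_{ij})_{i,j=1,2}$ invertible. The $z$-triangular automorphisms are those of the form $(\alpha_1x+p_1(y,z),\ \alpha_2y+p_2(z))$ with $\alpha_1,\alpha_2\in K^{\ast}=K\setminus\{0\}$, $p_1\in K\langle y,z\rangle$, $p_2\in K[z]$. A $z$-automorphism is $z$-tame if it belongs to the group generated by the $z$-affine and the $z$-triangular automorphisms (under composition). A polynomial $f\in K\langle x,y,z\rangle$ is a $z$-tame coordinate if $f=\varphi(x)$ for some $z$-tame automorphism $\varphi$. *)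

(* Defs.v *)
From HB Require Import structures.
From mathcomp Require Import all_boot all_order all_algebra.
From mathcomp Require Import finmap.
From mathcomp Require Export monalg.

Set Implicit Arguments.
Unset Strict Implicit.
Unset Printing Implicit Defensive.

Import GRing.Theory.
Local Open Scope ring_scope.

(* The model of computation is the WHILE language of N. D. Jones
   ("Computability and Complexity from a Programming Perspective"), in
   point-free form.  Its only data are binary trees; it is Turing complete. *)

Inductive tree : Type := Leaf | Node of tree & tree.

Definition tree_of_bool (b : bool) : tree := if b then Node Leaf Leaf else Leaf.

(* As a condition, [Leaf] stands for "false" and any [Node] for "true". *)
Inductive prog : Type :=
| PId
| PLeaf
| PFst
| PSnd
| PPair of prog & prog
| PComp of prog & prog            (* the second program is run first *)
| PIf of prog & prog & prog
| PWhile of prog & prog.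

(* [run p s t]: started on input [s], the program [p] halts with output [t]. *)
Inductive run : prog -> tree -> tree -> Prop :=
| run_id s : run PId s s
| run_leaf s : run PLeaf s Leaf
| run_fst_leaf : run PFst Leaf Leaf
| run_fst s t : run PFst (Node s t) s
| run_snd_leaf : run PSnd Leaf Leaf
| run_snd s t : run PSnd (Node s t) t
| run_pair p q s t u : run p s t -> run q s u -> run (PPair p q) s (Node t u)
| run_comp p q s t u : run q s t -> run p t u -> run (PComp p q) s u
| run_if_true c p q s a b t :
    run c s (Node a b) -> run p s t -> run (PIf c p q) s t
| run_if_false c p q s t :
    run c s Leaf -> run q s t -> run (PIf c p q) s t
| run_while_stop c p s : run c s Leaf -> run (PWhile c p) s s
| run_while_step c p s a b t u :
    run c s (Node a b) -> run p s t -> run (PWhile c p) t u ->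
    run (PWhile c p) s u.

Lemma run_det p s t t' : run p s t -> run p s t' -> t = t'.
Proof.
move=> r; elim: r t' => {p s t}.
- by move=> s t' r; inversion r.
- by move=> s t' r; inversion r.
- by move=> t' r; inversion r.
- by move=> s t t' r; inversion r.
- by move=> t' r; inversion r.
- by move=> s t t' r; inversion r.
- move=> p q s t u _ IHp _ IHq t' r; inversion r; subst.
  by congr Node; [apply: IHp | apply: IHq].
- move=> p q s t u _ IHq _ IHp t' r; inversion r; subst.
  by apply: IHp; rewrite (IHq _ H1).
- move=> c p q s a b t _ IHc _ IHp t' r; inversion r; subst; first exact: IHp.
  by move: (IHc _ H4).
- move=> c p q s t _ IHc _ IHq t' r; inversion r; subst; last exact: IHq.
  by move: (IHc _ H4).
- move=> c p s _ IHc t' r; inversion r; subst; first by [].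
  by move: (IHc _ H1).
- move=> c p s a b t u _ IHc _ IHp _ IHw t' r; inversion r; subst.
    by move: (IHc _ H3).
  by apply: IHw; rewrite (IHp _ H2).
Qed.

(* [nu t = Some a] means that the tree [t] represents the element [a].  An
   element may have several representations, and the set of trees that
   represent some element is not required to be decidable. *)

Record constructive_field (K : fieldType) (nu : tree -> option K) : Prop := {
  nu_surj : forall a : K, exists t, nu t = Some a;
  nu_add : exists p, forall s t a b, nu s = Some a -> nu t = Some b ->
    exists2 u, run p (Node s t) u & nu u = Some (a + b);
  nu_opp : exists p, forall s a, nu s = Some a ->
    exists2 u, run p s u & nu u = Some (- a);
  nu_mul : exists p, forall s t a b, nu s = Some a -> nu t = Some b ->
    exists2 u, run p (Node s t) u & nu u = Some (a * b);
  nu_inv : exists p, forall s a, nu s = Some a -> a != 0 ->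
    exists2 u, run p s u & nu u = Some a^-1;
  nu_eq : exists p, forall s t a b, nu s = Some a -> nu t = Some b ->
    run p (Node s t) (tree_of_bool (a == b))
}.

Notation word := {fmonom 'I_3}.

(* K<x,y,z>, as the algebra of the free monoid on three letters. *)
Notation free_alg K := {malg K[{fmonom 'I_3}]}.

Definition lx : 'I_3 := @Ordinal 3 0 isT.
Definition ly : 'I_3 := @Ordinal 3 1 isT.
Definition lz : 'I_3 := @Ordinal 3 2 isT.

Definition Xx (K : fieldType) : free_alg K := << fmu lx >>.
Definition Xy (K : fieldType) : free_alg K := << fmu ly >>.
Definition Xz (K : fieldType) : free_alg K := << fmu lz >>.
Arguments Xx {K}.
Arguments Xy {K}.
Arguments Xz {K}.

(* [p \in K<L>]: every word occurring in [p] uses letters of [L] only. *)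
Definition only_letters (K : fieldType) (L : seq 'I_3) (p : free_alg K) : Prop :=
  forall w : word, w \in msupp p -> {subset (w : seq 'I_3) <= L}.

Definition z_automorphism (K : fieldType)
    (phi : {lrmorphism free_alg K -> free_alg K}) : Prop :=
  bijective phi /\ phi Xz = Xz.

Definition z_affine (K : fieldType)
    (phi : {lrmorphism free_alg K -> free_alg K}) : Prop :=
  z_automorphism phi /\
  exists (alpha : 'M[K]_2) (alpha31 alpha32 beta1 beta2 : K),
    [/\ alpha \in unitmx,
        phi Xx = alpha 0 0 *: Xx + alpha 1 0 *: Xy + alpha31 *: Xz + beta1%:A
      & phi Xy = alpha 0 1 *: Xx + alpha 1 1 *: Xy + alpha32 *: Xz + beta2%:A].

Definition z_triangular (K : fieldType)
    (phi : {lrmorphism free_alg K -> free_alg K}) : Prop :=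
  z_automorphism phi /\
  exists (alpha1 alpha2 : K) (p1 p2 : free_alg K),
    [/\ alpha1 != 0 /\ alpha2 != 0,
        only_letters [:: ly; lz] p1,
        only_letters [:: lz] p2,
        phi Xx = alpha1 *: Xx + p1
      & phi Xy = alpha2 *: Xy + p2].

Inductive z_tame (K : fieldType) : (free_alg K -> free_alg K) -> Prop :=
| z_tame_affine (phi : {lrmorphism free_alg K -> free_alg K}) :
    z_affine phi -> z_tame phi
| z_tame_triangular (phi : {lrmorphism free_alg K -> free_alg K}) :
    z_triangular phi -> z_tame phi
| z_tame_id : z_tame id
| z_tame_comp phi psi : z_tame phi -> z_tame psi -> z_tame (phi \o psi)
| z_tame_inv phi psi :
    z_tame phi -> cancel phi psi -> cancel psi phi -> z_tame psi.

Definition z_tame_coordinate (K : fieldType) (f : free_alg K) : Prop :=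
  exists2 phi : free_alg K -> free_alg K, z_tame phi & f = phi Xx.

(* A polynomial is given as a list of terms, each a pair of (a representation
   of) a coefficient and a word.  The terms may come in any order, and the
   same word may occur several times.  Lists are [Leaf] (empty) and
   [Node head tail]. *)

Definition letter_of_tree (t : tree) : option 'I_3 :=
  match t with
  | Leaf => Some lx
  | Node Leaf Leaf => Some ly
  | Node Leaf (Node Leaf Leaf) => Some lz
  | _ => None
  end.

Fixpoint word_of_tree (t : tree) : option word :=
  match t with
  | Leaf => Some mone
  | Node l t' =>
      match letter_of_tree l, word_of_tree t' with
      | Some i, Some w => Some (mmul (fmu i) w)
      | _, _ => None
      end
  end.

Fixpoint poly_of_tree (K : fieldType) (nu : tree -> option K) (t : tree) :
    option (free_alg K) :=
  match t with
  | Leaf => Some 0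
  | Node (Node c m) t' =>
      match nu c, word_of_tree m, poly_of_tree nu t' with
      | Some a, Some w, Some g => Some (a *: << w >> + g)
      | _, _, _ => None
      end
  | _ => None
  end.

(* [p] halts on every representation of every polynomial, and answers
   correctly whether the polynomial satisfies [P]. *)
Definition decides_poly (K : fieldType) (nu : tree -> option K)
    (p : prog) (P : free_alg K -> Prop) : Prop :=
  forall t f, poly_of_tree nu t = Some f ->
    (P f -> run p t (tree_of_bool true)) /\
    (~ P f -> run p t (tree_of_bool false)).

Lemma word_of_tree_surj (w : word) : exists t, word_of_tree t = Some w.
Proof.
case: w => s; elim: s => [|i s [t IH]].
  by exists Leaf => /=; congr Some; apply: val_inj; rewrite /= fm1.
have [l El] : exists l, letter_of_tree l = Some i.
  case: i => [[|[|[|//]]] lti].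
  - by exists Leaf; congr Some; apply: val_inj.
  - by exists (Node Leaf Leaf); congr Some; apply: val_inj.
  - by exists (Node Leaf (Node Leaf Leaf)); congr Some; apply: val_inj.
by exists (Node l t); rewrite /= El IH; congr Some; apply: val_inj; rewrite /= fmM fmU.
Qed.

Lemma poly_of_tree_surj (K : fieldType) (nu : tree -> option K)
    (f : free_alg K) :
  constructive_field nu -> exists t, poly_of_tree nu t = Some f.
Proof.
move=> Knu; rewrite [f]monalgE.
elim: (X in \sum_(k <- X) _) => [|w s [t IH]].
  by exists Leaf; rewrite big_nil.
have [c Ec] := nu_surj Knu f@_w; have [m Em] := word_of_tree_surj w.
exists (Node (Node c m) t); rewrite /= Ec Em IH big_cons.
congr Some; congr (_ + _); apply/malgP => v.
by rewrite mcoeffZ !mcoeffU mulrnAr mulr1.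
Qed.

(* Main.v *)
Require Import Defs.
From mathcomp Require Import all_boot all_order all_algebra.
From HB Require Import structures.
From mathcomp Require Import finmap zify ring.

(* Apart from f = c y + b(z), every z-tame coordinate is f = T h, where T is
   triangular, x |-> a x + p(y,z), y |-> d y + b(z), and h is x or h = S T' h'
   with S the swap of x and y, T' triangular with p' not in K y + K[z], and h'
   again of this form: this set contains x and is stable under triangular maps
   and S, hence under the z-tame group, by the Bruhat decomposition of GL_2.

   Order words by (degree in x and y, degree in z, lexicographic order with
   z < x < y).  By induction h has a dominant word w in the letters x, z.  If v
   is the largest word of p and contains y, the largest word of T h is w with
   every x replaced by v, while the word obtained from w by replacing only its
   first x by v occurs in T h with coefficient c times that of w, where c a is
   the coefficient of v in p.  So v is a factor of a word of f, c is a quotient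
   of two coefficients of f, and x |-> x - c v makes the largest word smaller.
   If p is in K[z], the same applies to S f, unless f = a x + b(z).  Hence one
   can lower f by trying finitely many explicit maps x |-> x - c v and
   y |-> y - c v, and f is a z-tame coordinate if and only if this process,
   which always stops, ends with a x + b y + q(z), (a, b) <> 0. *)

Set Implicit Arguments.
Unset Strict Implicit.
Unset Printing Implicit Defensive.

Import GRing.Theory.
Local Open Scope ring_scope.

(** * The free algebra through its coefficients *)

(** The coefficient of the largest word of T h contains a power of the leading coefficient of p, so
    recovering c there would require roots, which a constructive field need not provide; in the word
    where a single x has been replaced it enters linearly, and a division suffices. As h and T are
    unknown, the pair (v, c) can only be searched for. The search never backtracks: x |-> x - c v
    with v free of x is a z-tame automorphism for every c, so each lowering step preserves both
    being and not being a coordinate, and the structure of the orbit serves only to show that a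
    coordinate at which no step is left is terminal. The delicate point is the swap, which does not
    respect the order. Lexicographic ties survive it between words without x, so the induction must
    control the letters of the words tied with the largest one. This control is lost when v = y,
    which is why p' in K y + K[z] is excluded from the inner factors. *)

(* The theory below uses the free algebra only through these properties: an
   abstract carrier keeps unification from unfolding the monoid algebra. *)
Record word_algebra (K : fieldType) := WordAlgebra {
  wa_carrier :> lalgType K;
  wa_mon : seq 'I_3 -> wa_carrier;
  wa_coef : wa_carrier -> seq 'I_3 -> K;
  wa_supp : wa_carrier -> seq (seq 'I_3);
  wa_coefD : forall g h w, wa_coef (g + h) w = wa_coef g w + wa_coef h w;
  wa_coefZ : forall c g w, wa_coef (c *: g) w = c * wa_coef g w;
  wa_coef_mon : forall u w, wa_coef (wa_mon u) w = (u == w)%:R;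
  wa_coefP : forall g h, wa_coef g =1 wa_coef h -> g = h;
  wa_supp_uniq : forall g, uniq (wa_supp g);
  wa_mem_supp : forall g w, (w \in wa_supp g) = (wa_coef g w != 0);
  wa_mon1 : wa_mon [::] = 1;
  wa_monMZ : forall c d u w,
    (c *: wa_mon u) * (d *: wa_mon w) = (c * d) *: wa_mon (u ++ w)
}.

Section WordAlgebraTheory.
Variables (K : fieldType) (A : word_algebra K).
Implicit Types (f g h : A) (u v w : seq 'I_3) (c : K) (l : 'I_3).

Local Notation mon := (@wa_mon K A).
Local Notation cf := (@wa_coef K A).
Local Notation supp := (@wa_supp K A).

Definition var l : A := mon [:: l].

Lemma cfD g h w : cf (g + h) w = cf g w + cf h w. Proof. exact: wa_coefD. Qed.
Lemma cfZ c g w : cf (c *: g) w = c * cf g w. Proof. exact: wa_coefZ. Qed.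
Lemma cf0 w : cf 0 w = 0. Proof. by rewrite -(scale0r 0) cfZ mul0r. Qed.
Lemma cfN g w : cf (- g) w = - cf g w. Proof. by rewrite -scaleN1r cfZ mulN1r. Qed.
Lemma cfB g h w : cf (g - h) w = cf g w - cf h w. Proof. by rewrite cfD cfN. Qed.
Lemma cf_sum (I : Type) (r : seq I) (P : pred I) (F : I -> A) w :
  cf (\sum_(i <- r | P i) F i) w = \sum_(i <- r | P i) cf (F i) w.
Proof. by apply: (big_morph (cf^~ w)); [move=> *; rewrite cfD | rewrite cf0]. Qed.

Lemma cf_mon u w : cf (mon u) w = (u == w)%:R. Proof. exact: wa_coef_mon. Qed.
Lemma cfP g h : cf g =1 cf h -> g = h. Proof. exact: wa_coefP. Qed.
Lemma mem_supp g w : (w \in supp g) = (cf g w != 0). Proof. exact: wa_mem_supp. Qed.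

Lemma mon1 : mon [::] = 1. Proof. exact: wa_mon1. Qed.

Lemma monM u w : mon (u ++ w) = mon u * mon w.
Proof. by have := wa_monMZ A 1 1 u w; rewrite !scale1r mulr1 scale1r. Qed.

Lemma mon_cons l w : mon (l :: w) = var l * mon w.
Proof. by rewrite -monM. Qed.

Lemma fa_expandW (s : seq (seq 'I_3)) g : uniq s -> {subset supp g <= s} ->
  g = \sum_(w <- s) cf g w *: mon w.
Proof.
move=> us sub; apply: cfP => v; rewrite cf_sum.
under eq_bigr do rewrite cfZ cf_mon.
case: (boolP (v \in s)) => [vs|nvs].
  rewrite (bigD1_seq v) //= eqxx mulr1 big1 ?addr0 // => w /negbTE ->.
  by rewrite mulr0.
rewrite big_seq big1 => [|w ws]; first by apply: contraNeq nvs => h; apply: sub; rewrite mem_supp.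
by case: eqP => [e|_]; [rewrite -e ws in nvs | rewrite mulr0].
Qed.

Lemma fa_expand g : g = \sum_(w <- supp g) cf g w *: mon w.
Proof. exact: fa_expandW (wa_supp_uniq g) _. Qed.

Lemma fa_ind (P : A -> Prop) :
  P 0 -> (forall c w g, P g -> P (c *: mon w + g)) -> forall g, P g.
Proof.
move=> P0 PD g; rewrite [g]fa_expand; elim: (X in \sum_(k <- X) _) => [|w s IH].
  by rewrite big_nil.
by rewrite big_cons; apply: PD.
Qed.

(** The carrier is only a left algebra, so this is derived from monomials, where [wa_monMZ] treats
    the scalars of both factors. *)
Lemma fa_scalerAr c g h : g * (c *: h) = c *: (g * h).
Proof.
elim/fa_ind: g h => [|a u g IH] h; first by rewrite !mul0r scaler0.
rewrite !mulrDl IH scalerDr; congr (_ + _); elim/fa_ind: h => [|b v h IHh].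
  by rewrite !(scaler0, mulr0).
rewrite scalerDr !mulrDr IHh scalerDr; congr (_ + _); rewrite scalerA !wa_monMZ.
by rewrite scalerA mulrCA.
Qed.

Lemma cfM f g w :
  cf (f * g) w = \sum_(i < (size w).+1) cf f (take i w) * cf g (drop i w).
Proof.
elim/fa_ind: f g => [|c u f IH] g.
  by rewrite mul0r cf0 big1 // => i _; rewrite cf0 mul0r.
rewrite mulrDl cfD IH -scalerAl cfZ; under [RHS]eq_bigr do rewrite cfD cfZ mulrDl -mulrA.
rewrite big_split /= -mulr_sumr; congr (_ * _ + _).
elim/fa_ind: g => [|b v g IHg].
  by rewrite mulr0 cf0 big1 // => i _; rewrite cf0 mulr0.
rewrite mulrDr cfD IHg fa_scalerAr -monM cfZ cf_mon.
under [RHS]eq_bigr do rewrite cfD cfZ mulrDr mulrCA.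
rewrite big_split /= -mulr_sumr; congr (_ * _ + _).
under eq_bigr do rewrite !cf_mon -natrM mulnb.
case: eqP => [<-|ne].
  have lt : (size u < (size (u ++ v)).+1)%N by rewrite size_cat ltnS leq_addr.
  rewrite (bigD1 (Ordinal lt)) //= take_size_cat // drop_size_cat // !eqxx.
  rewrite big1 ?addr0 // => -[i /= lti]; rewrite -val_eqE /= => ne.
  case: eqP => //= e; case/eqP: ne; move: lti; rewrite ltnS => lei.
  by rewrite e size_takel.
rewrite big1 // => i _; case: eqP => //= e1; case: eqP => // e2.
by case: ne; rewrite e1 e2 cat_take_drop.
Qed.

Lemma cfM_neq0 f g w : cf (f * g) w != 0 ->
  exists u v, [/\ w = u ++ v, cf f u != 0 & cf g v != 0].
Proof.
rewrite cfM => ne; case: (boolP [exists i : 'I_(size w).+1,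
  (cf f (take i w) != 0) && (cf g (drop i w) != 0)]).
  by case/existsP=> i /andP[? ?]; exists (take i w), (drop i w); rewrite cat_take_drop.
move/existsPn => no; case/negP: ne; rewrite big1 // => i _.
by move: (no i); rewrite negb_and !negbK => /orP[] /eqP->; rewrite ?mul0r ?mulr0.
Qed.

(** Most coefficient computations below come down to this: once degrees or maximality leave a single
    way of cutting the word, the convolution has one term. *)
Lemma cfM_uniq f g u v :
  (forall u' v', u' ++ v' = u ++ v -> cf f u' != 0 -> cf g v' != 0 -> u' = u) ->
  cf (f * g) (u ++ v) = cf f u * cf g v.
Proof.
move=> uniq; rewrite cfM.
have lt : (size u < (size (u ++ v)).+1)%N by rewrite size_cat ltnS leq_addr.
rewrite (bigD1 (Ordinal lt)) //= take_size_cat // drop_size_cat //.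
rewrite big1 ?addr0 // => i; rewrite -val_eqE /= => ne.
apply/eqP; rewrite mulf_eq0; apply/negbNE/negP; rewrite negb_or => /andP[h1 h2].
have e := uniq _ _ (cat_take_drop i (u ++ v)) h1 h2.
by case/eqP: ne; rewrite -[RHS](congr1 size e) size_takel // -ltnS.
Qed.

Section Sub.
Variable P : 'I_3 -> A.

Definition sub_word w : A := \prod_(l <- w) P l.
Definition sub g : A := \sum_(w <- supp g) cf g w *: sub_word w.

(** Linearity compares sums over the supports of different elements, so the sum must be allowed to
    run over any larger list. *)
Lemma subEW (s : seq (seq 'I_3)) g : uniq s -> {subset supp g <= s} ->
  sub g = \sum_(w <- s) cf g w *: sub_word w.
Proof.
move=> us ss; rewrite /sub [RHS](bigID (mem (supp g))) /= [X in _ + X]big1 ?addr0.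
  rewrite -[RHS]big_filter; apply: perm_big; apply: uniq_perm;
    rewrite ?filter_uniq ?wa_supp_uniq //.
  by move=> w; rewrite mem_filter andb_idr //; apply: ss.
by move=> w; rewrite mem_supp negbK => /eqP->; rewrite scale0r.
Qed.

Fact sub_is_linear : linear sub.
Proof.
move=> c g h; pose s := undup (supp g ++ supp h).
have us : uniq s by rewrite undup_uniq.
have ss : forall w, (w \in s) = (w \in supp g) || (w \in supp h).
  by move=> w; rewrite mem_undup mem_cat.
rewrite (@subEW s) // => [|w]; last first.
  rewrite ss !mem_supp cfD cfZ; apply: contraR.
  by rewrite negb_or !negbK => /andP[/eqP-> /eqP->]; rewrite mulr0 addr0.
rewrite (@subEW s g) // => [|w wg]; last by rewrite ss wg.
rewrite (@subEW s h) // => [|w wg]; last by rewrite ss wg orbT.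
rewrite scaler_sumr -big_split; apply: eq_bigr => w _ /=.
by rewrite cfD cfZ scalerDl scalerA.
Qed.

HB.instance Definition _ :=
  GRing.isLinear.Build K A A *:%R sub sub_is_linear.

Lemma sub_mon w : sub (mon w) = sub_word w.
Proof.
rewrite (@subEW [:: w]) // => [|v]; first by rewrite big_seq1 cf_mon eqxx scale1r.
by rewrite mem_supp cf_mon inE [v == w]eq_sym; case: (w == v) => //; rewrite eqxx.
Qed.

Fact sub_is_monoid_morphism : monoid_morphism sub.
Proof.
split; first by rewrite -{1}mon1 sub_mon /sub_word big_nil.
move=> g h; elim/fa_ind: g => [|c u g IH]; first by rewrite mul0r linear0 mul0r.
rewrite mulrDl !linearD /= IH mulrDl -scalerAl !linearZ /= -scalerAl; congr (_ *: _ + _).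
elim/fa_ind: h {IH} => [|b v h IHh]; first by rewrite mulr0 linear0 mulr0.
rewrite mulrDr !linearD /= IHh mulrDr fa_scalerAr !linearZ /= fa_scalerAr; congr (_ *: _ + _).
by rewrite -monM !sub_mon /sub_word big_cat.
Qed.

HB.instance Definition _ :=
  GRing.isMonoidMorphism.Build A A sub sub_is_monoid_morphism.

Lemma sub_var l : sub (var l) = P l.
Proof. by rewrite sub_mon /sub_word big_seq1. Qed.

End Sub.

Lemma lrmorph_ext (phi psi : {lrmorphism A -> A}) :
  (forall l, phi (var l) = psi (var l)) -> phi =1 psi.
Proof.
move=> e; elim/fa_ind => [|c w g IH]; first by rewrite !linear0.
rewrite !linearD /= IH !linearZ /=; congr (_ *: _ + _).
elim: w => [|l w IHw]; first by rewrite mon1 !rmorph1.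
by rewrite mon_cons !rmorphM /= e IHw.
Qed.

End WordAlgebraTheory.

(** * The free algebra on x, y, z as a word algebra *)

Section FreeAlgebra.
Variable K : fieldType.
Implicit Types (f g h : free_alg K) (u v w : seq 'I_3) (c : K) (l : 'I_3).

Definition free_coef g w : K := g@_(FMonom w).
Definition free_mon w : free_alg K := << FMonom w >>.
Definition free_supp g : seq (seq 'I_3) := [seq (k : seq 'I_3) | k : word <- msupp g].

Lemma FMonom_cat u w : FMonom (u ++ w) = mmul (FMonom u) (FMonom w) :> word.
Proof. by apply: val_inj; rewrite /= fmM. Qed.

Lemma free_coef_mon u w : free_coef (free_mon u) w = (u == w)%:R.
Proof. by rewrite /free_coef /free_mon mcoeffU1 fmP. Qed.

Lemma free_coefP g h : free_coef g =1 free_coef h -> g = h.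
Proof. by move=> e; apply/malgP => -[w]; apply: e. Qed.

Lemma free_monU c w : << c *g FMonom w >> = c *: free_mon w.
Proof.
by apply/malgP => -[v]; rewrite mcoeffZ /free_mon mcoeffU1 mcoeffU mulr_natr.
Qed.

Lemma free_supp_uniq g : uniq (free_supp g).
Proof. by rewrite map_inj_uniq ?fset_uniq //; apply: val_inj. Qed.

Lemma free_mem_supp g w : (w \in free_supp g) = (free_coef g w != 0).
Proof.
rewrite mcoeff_neq0; apply/mapP/idP => [[[v] vg ->]//|h].
by exists (FMonom w).
Qed.

Lemma free_mon1 : free_mon [::] = 1.
Proof. by rewrite /free_mon -fmoneE. Qed.

Lemma free_monMZ c d u w :
  (c *: free_mon u) * (d *: free_mon w) = (c * d) *: free_mon (u ++ w).
Proof. by rewrite -!free_monU malgM_def fgmulUU FMonom_cat. Qed.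

Lemma free_coefD g h w : free_coef (g + h) w = free_coef g w + free_coef h w.
Proof. exact: mcoeffD. Qed.
Lemma free_coefZ c g w : free_coef (c *: g) w = c * free_coef g w.
Proof. exact: mcoeffZ. Qed.

Definition free_word_algebra : word_algebra K :=
  @WordAlgebra K (free_alg K) free_mon free_coef free_supp free_coefD free_coefZ
    free_coef_mon free_coefP free_supp_uniq free_mem_supp free_mon1 free_monMZ.

End FreeAlgebra.

(** * Words and their order *)

Section Words.
Implicit Types (u v w s t : seq 'I_3) (l : 'I_3).
Local Open Scope nat_scope.

Lemma letterP l : [\/ l = lx, l = ly | l = lz].
Proof.
by case: l => -[|[|[|//]]] lt3; [apply: Or31 | apply: Or32 | apply: Or33]; apply: val_inj.
Qed.

Definition nx u := count_mem lx u.
Definition ny u := count_mem ly u.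
Definition nz u := count_mem lz u.
Global Arguments nx : simpl never.
Global Arguments ny : simpl never.
Global Arguments nz : simpl never.

Lemma nx_cat u v : nx (u ++ v) = nx u + nx v. Proof. exact: count_cat. Qed.
Lemma ny_cat u v : ny (u ++ v) = ny u + ny v. Proof. exact: count_cat. Qed.
Lemma nz_cat u v : nz (u ++ v) = nz u + nz v. Proof. exact: count_cat. Qed.
Definition n_cat := (nx_cat, ny_cat, nz_cat).

Lemma nx_cons l u : nx (l :: u) = (l == lx) + nx u. Proof. by []. Qed.
Lemma ny_cons l u : ny (l :: u) = (l == ly) + ny u. Proof. by []. Qed.
Lemma nz_cons l u : nz (l :: u) = (l == lz) + nz u. Proof. by []. Qed.
Lemma n_nil : (nx [::] = 0) * (ny [::] = 0) * (nz [::] = 0). Proof. by []. Qed.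
Definition nE := (n_cat, nx_cons, ny_cons, nz_cons, n_nil).

Lemma size_count u : size u = nx u + ny u + nz u.
Proof. by elim: u => //= l u ->; rewrite !nE; case: (letterP l) => -> /=; lia. Qed.

Lemma nx_mem u : (lx \in u) = (0 < nx u). Proof. by rewrite -has_count has_pred1. Qed.
Lemma ny_mem u : (ly \in u) = (0 < ny u). Proof. by rewrite -has_count has_pred1. Qed.

Definition digit l : nat := if l == ly then 2 else if l == lx then 1 else 0.

Lemma digit_inj : injective digit.
Proof. by move=> l k; case: (letterP l) => ->; case: (letterP k) => ->. Qed.

(** [wlt] consults it only between words of equal length, where neither can be a proper prefix of
    the other. *)
Fixpoint lexlt u w : bool :=
  match u, w with
  | a :: u', b :: w' => (digit a < digit b) || (a == b) && lexlt u' w'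
  | _, _ => false
  end.

(* A monoid order in which every word in y and z containing y is above x. *)
Definition wtlt u w : bool :=
  (nx u + ny u < nx w + ny w) || (nx u + ny u == nx w + ny w) && (nz u < nz w).
Definition wteq u w : bool := (nx u + ny u == nx w + ny w) && (nz u == nz w).

Definition wlt u w : bool := wtlt u w || wteq u w && lexlt u w.
Definition wle u w : bool := (u == w) || wlt u w.

Lemma wteq_size u w : wteq u w -> size u = size w.
Proof. by rewrite /wteq !size_count; lia. Qed.

Lemma lexlt_irr u : lexlt u u = false.
Proof. by elim: u => //= l u ->; rewrite ltnn andbF. Qed.

Lemma lexlt_trans u v w : lexlt u v -> lexlt v w -> lexlt u w.
Proof.
elim: u v w => [|a u IH] [|b v] [|c w] //= /orP[h|/andP[/eqP-> h]] /orP[h'|/andP[/eqP<- h']].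
- by rewrite (ltn_trans h h').
- by rewrite h.
- by rewrite h'.
- by rewrite (IH _ _ h h') eqxx orbT.
Qed.

Lemma lexlt_total u w : size u = size w -> [\/ u = w, lexlt u w | lexlt w u].
Proof.
elim: u w => [|a u IH] [|b w] //=; first by move=> _; apply: Or31.
move=> [/IH e]; case: (ltngtP (digit a) (digit b)) => [_|_|/digit_inj->];
  [exact: Or32|exact: Or33|].
by rewrite eqxx; case: e => [->|h|h]; [apply: Or31 | apply: Or32 | apply: Or33].
Qed.

Lemma lexlt_cat u u' v v' : size u = size u' ->
  lexlt (u ++ v) (u' ++ v') = lexlt u u' || (u == u') && lexlt v v'.
Proof.
elim: u u' => [|a u IH] [|b u'] //= [e]; rewrite (IH _ e) eqseq_cons.
by case: (digit a < digit b); case: (a == b); case: lexlt.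
Qed.

Lemma lexlt_cat2l a u w : lexlt (a ++ u) (a ++ w) = lexlt u w.
Proof. by rewrite lexlt_cat // lexlt_irr eqxx. Qed.

Lemma wlt_irr u : wlt u u = false.
Proof. by rewrite /wlt /wtlt lexlt_irr !ltnn !andbF. Qed.

Lemma wlt_trans u v w : wlt u v -> wlt v w -> wlt u w.
Proof.
rewrite /wlt => /orP[h|/andP[h l]] /orP[h'|/andP[h' l']].
- by apply/orP; left; move: h h'; rewrite /wtlt; lia.
- by apply/orP; left; move: h h'; rewrite /wtlt /wteq; lia.
- by apply/orP; left; move: h h'; rewrite /wtlt /wteq; lia.
- by apply/orP; right; rewrite (lexlt_trans l l') andbT; move: h h'; rewrite /wteq; lia.
Qed.

Lemma wlt_total u w : [\/ u = w, wlt u w | wlt w u].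
Proof.
case: (boolP (wtlt u w)) => [h|h]; first by apply: Or32; rewrite /wlt h.
case: (boolP (wtlt w u)) => [h'|h']; first by apply: Or33; rewrite /wlt h'.
have e : wteq u w by move: h h'; rewrite /wtlt /wteq; lia.
have e' : wteq w u by move: e; rewrite /wteq; lia.
by case: (lexlt_total (wteq_size e)) => l; [apply: Or31|apply: Or32|apply: Or33];
  rewrite // /wlt l ?e ?e' orbT.
Qed.

Lemma wle_refl u : wle u u. Proof. by rewrite /wle eqxx. Qed.

Lemma wle_trans u v w : wle u v -> wle v w -> wle u w.
Proof.
rewrite /wle => /orP[/eqP->//|h] /orP[/eqP<-|h']; first by rewrite h orbT.
by rewrite (wlt_trans h h') orbT.
Qed.

Lemma wle_lt_trans u v w : wle u v -> wlt v w -> wlt u w.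
Proof. by rewrite /wle => /orP[/eqP->//|h]; apply: wlt_trans. Qed.

Lemma wlt_le_trans u v w : wlt u v -> wle v w -> wlt u w.
Proof. by rewrite /wle => h /orP[/eqP<-//|]; apply: wlt_trans. Qed.

Lemma wle_anti u v : wle u v -> wle v u -> u = v.
Proof.
by rewrite {1}/wle => /orP[/eqP->//|h] h'; have := wlt_le_trans h h'; rewrite wlt_irr.
Qed.

Lemma wlt_catr u u' v : wlt u u' -> wlt (u ++ v) (u' ++ v).
Proof.
rewrite /wlt => /orP[h|/andP[h l]].
  by apply/orP; left; move: h; rewrite /wtlt !n_cat; lia.
apply/orP; right; rewrite lexlt_cat ?l ?(wteq_size h) // andbT.
by move: h; rewrite /wteq !n_cat; lia.
Qed.

Lemma wlt_catl u v v' : wlt v v' -> wlt (u ++ v) (u ++ v').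
Proof.
rewrite /wlt => /orP[h|/andP[h l]].
  by apply/orP; left; move: h; rewrite /wtlt !n_cat; lia.
apply/orP; right; rewrite lexlt_cat2l l andbT.
by move: h; rewrite /wteq !n_cat; lia.
Qed.

Lemma wle_catl u v v' : wle v v' -> wle (u ++ v) (u ++ v').
Proof. by case/orP => [/eqP->|h]; [exact: wle_refl | rewrite /wle wlt_catl ?orbT]. Qed.

Lemma wle_catr u u' v : wle u u' -> wle (u ++ v) (u' ++ v).
Proof. by case/orP => [/eqP->|h]; [exact: wle_refl | rewrite /wle wlt_catr ?orbT]. Qed.

Lemma wle_cat u u' v v' : wle u u' -> wle v v' -> wle (u ++ v) (u' ++ v').
Proof. by move=> h h'; apply: wle_trans (wle_catl _ h') (wle_catr _ h). Qed.

Lemma wlt_cat u u' v v' : wlt u u' -> wle v v' -> wlt (u ++ v) (u' ++ v').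
Proof. by move=> h h'; apply: wle_lt_trans (wle_catl _ h') (wlt_catr _ h). Qed.

(** Largest words cut in one way only: this supplies the uniqueness that [cfM_uniq] asks for. *)
Lemma wle_cat_eq u u' v v' : wle u u' -> wle v v' -> u ++ v = u' ++ v' -> u = u'.
Proof.
rewrite {1}/wle => /orP[/eqP->//|h] h' e.
by have := wlt_cat h h'; rewrite e wlt_irr.
Qed.

Lemma wle_wt u w : wle u w -> wtlt u w || wteq u w.
Proof.
rewrite /wle /wlt => /orP[/eqP->|/orP[->//|/andP[-> _]]]; last by rewrite orbT.
by rewrite /wteq !eqxx orbT.
Qed.

(** The base 3 value turns the lexicographic comparison of words of equal length into one of
    numbers. It serves twice: for well-foundedness and for a program that decides [wlt]. *)
Definition val3 u : nat := foldl (fun n l => n * 3 + digit l) 0 u.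

Lemma val3_cat u v : val3 (u ++ v) = val3 u * 3 ^ size v + val3 v.
Proof.
rewrite /val3 foldl_cat; move: (foldl _ 0 u) => n.
elim: v n => [|l v IH] n /=; first by rewrite expn0; lia.
by rewrite IH (IH (0 * 3 + digit l)) expnS; ring.
Qed.

Lemma val3_lt u : val3 u < 3 ^ size u.
Proof.
elim/last_ind: u => [|u l IH] //; rewrite -cats1 val3_cat size_cat /= addn1 (expnSr 3 (size u))
  -[3 ^ 1]/3.
have : digit l <= 2 by rewrite /digit; case: ifP => // _; case: ifP.
by rewrite [val3 [:: l]](_ : _ = digit l) //; lia.
Qed.

Lemma lexlt_val3 u w : size u = size w -> lexlt u w = (val3 u < val3 w).
Proof.
elim: u w => [|a u IH] [|b w] //= [e].
rewrite -[a :: u]cat1s -[b :: w]cat1s !val3_cat -e.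
have hu := val3_lt u; have hw := val3_lt w; rewrite -e in hw.
have -> : val3 [:: a] = digit a by []. have -> : val3 [:: b] = digit b by [].
rewrite (IH _ e); case: (ltngtP (digit a) (digit b)) => [h|h|/digit_inj->] /=;
  last by rewrite eqxx; lia.
- by symmetry; nia.
- have /negbTE-> : a != b by apply: contraTneq h => ->; rewrite ltnn.
  by symmetry; apply/negbTE; nia.
Qed.

(** The order is that of the triples (degree in x and y, degree in z, base 3 value), compared
    lexicographically. *)
Lemma wlt_wf : well_founded (fun u w : seq 'I_3 => wlt u w).
Proof.
have H : forall a b c u, nx u + ny u = a -> nz u = b -> val3 u = c ->
    Acc (fun u w : seq 'I_3 => wlt u w) u.
  elim/ltn_ind => a IHa; elim/ltn_ind => b IHb; elim/ltn_ind => c IHc u ea eb ec.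
  constructor=> t; rewrite /wlt /wtlt -orbA => /or3P[h|/andP[/eqP e h]|/andP[q l]].
  - by apply: IHa (erefl _) (erefl _) (erefl _); rewrite -ea.
  - by apply: IHb (erefl _) (erefl _); [rewrite -eb | rewrite e].
  - rewrite (lexlt_val3 (wteq_size q)) in l; case/andP: q => /eqP e1 /eqP e2.
    by apply: IHc (erefl _); [rewrite -ec | rewrite e1 | rewrite e2].
by move=> u; apply: H (erefl _) (erefl _) (erefl _).
Qed.

Definition subst_x v u : seq 'I_3 := flatten [seq if l == lx then v else [:: l] | l <- u].

Lemma subst_x_cat v u u' : subst_x v (u ++ u') = subst_x v u ++ subst_x v u'.
Proof. by rewrite /subst_x map_cat flatten_cat. Qed.

Lemma subst_x_cons v l u : subst_x v (l :: u) = (if l == lx then v else [:: l]) ++ subst_x v u.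
Proof. by []. Qed.

Lemma n_subst_x v u :
  [/\ nx (subst_x v u) = nx u * nx v, ny (subst_x v u) = nx u * ny v + ny u
    & nz (subst_x v u) = nx u * nz v + nz u].
Proof.
elim: u => [|l u [h1 h2 h3]] //; rewrite subst_x_cons !n_cat h1 h2 h3 !nE.
by case: (letterP l) => -> /=; rewrite ?nE /=; split; lia.
Qed.

Lemma zprefix v : 0 < ny v -> nx v = 0 -> exists r v1, v = nseq r lz ++ ly :: v1.
Proof.
elim: v => //= l v IH; rewrite !nE; case: (letterP l) => -> //=; first by exists 0, v.
by move=> h1 h2; case: IH => // r [v1 ->]; exists r.+1, v1.
Qed.

Lemma lexlt_zprefix r s r' t : r' < r ->
  lexlt (nseq r lz ++ s) (nseq r' lz ++ ly :: t).
Proof. by elim: r r' => // r IH [_|r' /IH] //=; rewrite ltnn eqxx => ->. Qed.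

(** At the first difference u has z and w has x. As both have equally many x, another x follows in
    u, after m further letters z. With v = z^r y v', the images continue there with at least m + 1 +
    r letters z against z^r y, and z is the smallest letter. *)
Lemma lexlt_subst_x v u w : nx v = 0 -> 0 < ny v -> ny u = 0 -> ny w = 0 ->
  nx u = nx w -> lexlt u w -> lexlt (subst_x v u) (subst_x v w).
Proof.
move=> v0 v1; have [r [v' ev]] := zprefix v1 v0.
elim: u w => [|a u IH] [|b w] //; rewrite !subst_x_cons.
rewrite !nE; case: (letterP a) => ->; case: (letterP b) => -> //= hu hw hn.
- by rewrite lexlt_cat2l /=; apply: IH => //; lia.
- move=> _; have {}hn : 0 < nx u by lia.
  have {hn} [m [u' ->]] : exists m u', u = nseq m lz ++ lx :: u'.
    elim: u hu hn {IH} => // l u IH; rewrite !nE; case: (letterP l) => -> //=; first by exists 0, u.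
    by move=> h1 h2; case: IH => // m [u' ->]; exists m.+1, u'.
  rewrite subst_x_cat subst_x_cons /= ev -!catA.
  have -> : subst_x (nseq r lz ++ ly :: v') (nseq m lz) = nseq m lz.
    by elim: m => //= m e; rewrite subst_x_cons /= e.
  by rewrite [nseq m lz ++ nseq r lz ++ _]catA -nseqD; apply: (@lexlt_zprefix (m + r).+1); lia.
- by move=> h; apply: IH.
Qed.

End Words.

(** * Leading words of images under triangular maps *)

Section Leading.
Variables (K : fieldType) (A : word_algebra K).
Implicit Types (f g h : A) (u v w s t T : seq 'I_3) (c : K) (l : 'I_3).

Local Notation mon := (@wa_mon K A).
Local Notation cf := (@wa_coef K A).
Local Notation supp := (@wa_supp K A).
Local Notation var := (@var K A).

Definition in_yz g := forall s, cf g s != 0 -> nx s = 0%N.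
Definition in_z g := forall s, cf g s != 0 -> nx s = 0%N /\ ny s = 0%N.

Lemma addr_neq0 (a b : K) : a + b != 0 -> (a != 0) \/ (b != 0).
Proof. by case: (eqVneq a 0) => [->|]; [rewrite add0r; right | left]. Qed.

Lemma cf_var l s : cf (var l) s = (s == [:: l])%:R.
Proof. by rewrite cf_mon eq_sym. Qed.

Lemma cf_scale_var a l s : cf (a *: var l) s != 0 -> s = [:: l].
Proof. by rewrite cfZ cf_var; case: (s =P _) => // _; rewrite mulr0 eqxx. Qed.

Record triangular (phi : {lrmorphism A -> A}) (alpha delta : K) (p b : A) : Prop :=
  Triangular {
    tri_alpha : alpha != 0;
    tri_delta : delta != 0;
    tri_yz : in_yz p;
    tri_z : in_z b;
    tri_x : phi (var lx) = alpha *: var lx + p;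
    tri_y : phi (var ly) = delta *: var ly + b;
    tri_fix_z : phi (var lz) = var lz }.

(** The condition on y makes v larger than x, hence the largest word of the image of x; words in z
    alone are all below x. *)
Definition lead p v : Prop :=
  [/\ cf p v != 0, (0 < ny v)%N & forall s, cf p s != 0 -> wle s v].

Section Triangular.
Variables (phi : {lrmorphism A -> A}) (alpha delta : K) (p b : A).
Hypothesis tri : triangular phi alpha delta p b.

Lemma tri_img_supp l s : cf (phi (var l)) s != 0 ->
  [\/ s = [:: l], l = lx /\ cf p s != 0 | l = ly /\ cf b s != 0].
Proof.
case: (letterP l) => ->; rewrite ?(tri_x tri) ?(tri_y tri) ?(tri_fix_z tri).
- by rewrite cfD => /addr_neq0[/cf_scale_var->|h]; [apply: Or31 | apply: Or32].
- by rewrite cfD => /addr_neq0[/cf_scale_var->|h]; [apply: Or31 | apply: Or33].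
- by rewrite cf_var; case: (s =P _) => [->|]; rewrite ?eqxx // => *; apply: Or31.
Qed.

Lemma tri_mon_nil T : cf (phi (mon [::])) T != 0 -> T = [::].
Proof.
by rewrite mon1 rmorph1 -mon1 cf_mon; case: ([::] =P T) => // _; rewrite eqxx.
Qed.

Lemma tri_mon_cons l u T : cf (phi (mon (l :: u))) T != 0 ->
  exists s T', [/\ T = s ++ T', cf (phi (var l)) s != 0 & cf (phi (mon u)) T' != 0].
Proof. by rewrite mon_cons rmorphM; apply: cfM_neq0. Qed.

Lemma tri_nx u T : cf (phi (mon u)) T != 0 -> (nx T <= nx u)%N.
Proof.
elim: u T => [|l u IH] T; first by move/tri_mon_nil->.
case/tri_mon_cons => s [T' [-> /tri_img_supp hs /IH le]].
by case: hs => [->|[-> /(tri_yz tri) hs]|[-> /(tri_z tri) [hs _]]]; rewrite !nE ?hs /=; lia.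
Qed.

(** Every x of u has been kept, so only letters y can have changed, each into a word in z alone,
    which lowers the degree in y. *)
Lemma tri_keep_x u T : cf (phi (mon u)) T != 0 -> nx T = nx u ->
  (ny T <= ny u)%N /\ (ny T = ny u -> T = u).
Proof.
elim: u T => [|l u IH] T; first by move/tri_mon_nil->.
case/tri_mon_cons => s [T' [-> /tri_img_supp hs h']].
have le := tri_nx h'; have {}IH := IH _ h'.
case: hs => [->|[-> /(tri_yz tri) hs]|[-> /(tri_z tri) [hs1 hs2]]]; rewrite !nE /= => e.
- case: IH => [|le' e']; first by lia.
  by split=> [|e2]; [lia | rewrite e' //; lia].
- by rewrite hs in e; lia.
- by rewrite hs1 hs2 in e *; case: IH => [|le' e']; [lia | split; lia].
Qed.

(** Words of p contain no x, so losing one x means that exactly one occurrence was replaced. *)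
Lemma tri_drop_x u T : cf (phi (mon u)) T != 0 -> ny u = 0%N -> nx u = (nx T).+1 ->
  exists u1 s u2, [/\ u = u1 ++ lx :: u2, T = u1 ++ s ++ u2 & cf p s != 0].
Proof.
elim: u T => [|l u IH] T //.
case/tri_mon_cons => s [T' [-> /tri_img_supp hs h']]; rewrite !nE => hy.
have {}IH := IH _ h'; have kx := tri_keep_x h'.
case: hs => [->|[el ps]|[el _]]; last by rewrite el in hy.
- rewrite !nE addn0 => e.
  case: IH => [||u1 [s' [u2 [-> -> ps]]]]; [by lia|by lia|].
  by exists (l :: u1), s', u2.
- rewrite (tri_yz tri ps) el /= => e.
  case: kx => [|le eq]; first by lia.
  by exists [::], s, u; rewrite eq //; lia.
Qed.

(** A replaced x is lost for good, since the words of p contain none; so u arises from itself only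
    by keeping every letter. *)
Lemma tri_mon_diag u : ny u = 0%N -> cf (phi (mon u)) u = alpha ^+ nx u.
Proof.
elim: u => [|l u IH]; first by rewrite mon1 rmorph1 -mon1 cf_mon.
rewrite !nE => hy; have yu : ny u = 0%N by lia.
rewrite mon_cons rmorphM -cat1s cfM_uniq ?IH // => [|u' v' e h1 h2].
  case: (letterP l) hy => -> //= _; rewrite ?(tri_x tri) ?(tri_fix_z tri).
    rewrite cfD cfZ cf_var eqxx mulr1; case: (eqVneq (cf p [:: lx]) 0) => [->|/(tri_yz tri)//].
    by rewrite addr0 -exprS.
  by rewrite cf_var eqxx mul1r.
case: (tri_img_supp h1) => [//|[el ps]|[el _]]; last by rewrite el in hy.
by move: (congr1 nx e) (tri_nx h2); rewrite el !nE (tri_yz tri ps) /=; lia.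
Qed.

Lemma cf_tri g T : cf (phi g) T = \sum_(u <- supp g) cf g u * cf (phi (mon u)) T.
Proof.
rewrite {1}(fa_expand g) linear_sum cf_sum; apply: eq_bigr => u _.
by rewrite linearZ cfZ.
Qed.

Lemma cf_tri_neq0 g T : cf (phi g) T != 0 ->
  exists u, cf g u != 0 /\ cf (phi (mon u)) T != 0.
Proof.
rewrite cf_tri => ne.
have /hasP[u ug /andP[h1 h2]] : has (fun u => (cf g u != 0) && (cf (phi (mon u)) T != 0)) (supp g).
  apply: contraNT ne => /hasPn no; rewrite big_seq big1 // => u /no.
  by rewrite negb_and !negbK => /orP[] /eqP->; rewrite ?mul0r ?mulr0.
by exists u.
Qed.

Lemma cf_tri_uniq g T w :
  (forall u, cf g u != 0 -> cf (phi (mon u)) T != 0 -> u = w) ->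
  cf (phi g) T = cf g w * cf (phi (mon w)) T.
Proof.
move=> uniq; rewrite cf_tri; case: (boolP (w \in supp g)) => wg.
  rewrite (bigD1_seq w) ?wa_supp_uniq //= big_seq_cond big1 ?addr0 // => u /andP[ug ne].
  rewrite mem_supp in ug; apply/eqP; rewrite mulf_eq0 (negbTE ug) /=.
  by apply: contraNT ne => /(uniq _ ug)->.
rewrite mem_supp negbK in wg; rewrite (eqP wg) mul0r big_seq big1 // => u ug.
rewrite mem_supp in ug; apply/eqP; rewrite mulf_eq0 (negbTE ug) /=.
by apply/negbNE/negP => /(uniq _ ug) e; rewrite e (eqP wg) eqxx in ug.
Qed.

Section LeadingWord.
Variable v : seq 'I_3.
Hypothesis pv : lead p v.

Lemma lead_nx : nx v = 0%N.
Proof. by case: pv => /(tri_yz tri). Qed.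

Lemma lead_ny : (0 < ny v)%N.
Proof. by case: pv. Qed.

(** The first x cannot be kept, because v is nonempty and free of x. Counting x then shows that all
    of t is kept, so the word arises in one way only. *)
Lemma tri_mon_replace k t : ny t = 0%N ->
  cf (phi (mon (nseq k lz ++ lx :: t))) (nseq k lz ++ v ++ t) = cf p v * alpha ^+ nx t.
Proof.
move=> yt; elim: k => [|k IH] /=.
  rewrite mon_cons rmorphM cfM_uniq ?tri_mon_diag // => [|u' v' e h1 h2].
    congr (_ * _); rewrite /= (tri_x tri) cfD cfZ cf_var.
    by case: (v =P _) => [ev|_]; [move: lead_nx; rewrite ev | rewrite mulr0 add0r].
  case: (tri_img_supp h1) => [eu|[_ ps]|[]//].
    by move: e lead_nx lead_ny; rewrite eu; case: v => //= l v2 [<- _].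
  have [|le ev] := tri_keep_x h2.
    by move: (congr1 nx e); rewrite !nx_cat (tri_yz tri ps) lead_nx; lia.
  have ev' : v' = t by apply: ev; move: le; rewrite yt; lia.
  have sz : size u' = size v by move: (congr1 size e); rewrite !size_cat ev'; lia.
  by move/eqP: e; rewrite eqseq_cat // => /andP[/eqP].
rewrite mon_cons rmorphM -[lz :: (_ ++ v ++ t)]cat1s cfM_uniq ?IH => [|u' v' e h1 h2].
  by rewrite /= (tri_fix_z tri) cf_var eqxx mul1r.
by case: (tri_img_supp h1) => [//|[]//|[]//].
Qed.

Lemma x_lt_v : wlt [:: lx] v.
Proof.
rewrite /wlt /wtlt /wteq; case: (boolP (v == [:: ly])) => [/eqP->//|ne].
apply/orP; left; rewrite lead_nx !nE /=.
have : (size v != 1) || (v == [:: ly]).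
  by case: v lead_nx lead_ny => [|l [|]] //=; case: (letterP l) => ->.
by rewrite (negbTE ne) orbF size_count lead_nx; have := lead_ny; lia.
Qed.

(** The word y is the only leading word with the degrees of x. The conditions [v != [:: ly]] below
    go back to this exception. *)
Lemma x_wtlt_v : v != [:: ly] -> wtlt [:: lx] v.
Proof.
move=> ne; have := x_lt_v; rewrite /wlt => /orP[//|/andP[/wteq_size]].
by case: v lead_nx lead_ny ne => [|l [|]] //=; case: (letterP l) => ->.
Qed.

Lemma tri_img_le l s : cf (phi (var l)) s != 0 -> wle s (if l == lx then v else [:: l]).
Proof.
case/tri_img_supp => [->|[-> ps]|[-> bs]].
- by case: eqP => [->|_]; [rewrite /wle x_lt_v orbT | apply: wle_refl].
- by rewrite eqxx; case: pv => _ _; apply.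
- rewrite /= /wle; apply/orP; right; apply/orP; left.
  by case: (tri_z tri bs) => h1 h2; rewrite /wtlt h1 h2.
Qed.

Lemma tri_mon_le u T : cf (phi (mon u)) T != 0 -> wle T (subst_x v u).
Proof.
elim: u T => [|l u IH] T; first by move/tri_mon_nil->; apply: wle_refl.
case/tri_mon_cons => s [T' [-> /tri_img_le hs /IH le]]; rewrite subst_x_cons.
exact: wle_cat.
Qed.

(** An x in T was kept where the heavier v could have been put. Such words must lose by degree
    alone, because the swap of x and y may reverse lexicographic comparisons in which x occurs. *)
Lemma tri_mon_wtlt u T : v != [:: ly] -> cf (phi (mon u)) T != 0 -> (0 < nx T)%N ->
  wtlt T (subst_x v u).
Proof.
move=> vy; elim: u T => [|l u IH] T; first by move/tri_mon_nil->.
case/tri_mon_cons => s [T' [-> hs hT]]; rewrite nx_cat addn_gt0 subst_x_cons.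
have /wle_wt le1 := tri_img_le hs; have /wle_wt le2 := tri_mon_le hT.
case/orP => [|/(IH _ hT)]; last by move: le1 le2; rewrite /wtlt /wteq !n_cat; lia.
case/tri_img_supp: hs => [->|[-> ps]|[-> bs]].
- case: (letterP l) => -> //= _; move: (x_wtlt_v vy) le1 le2.
  by rewrite /wtlt /wteq !nE /=; lia.
- by rewrite (tri_yz tri ps).
- by case: (tri_z tri bs) => ->.
Qed.

Lemma tri_mon_lead u :
  cf (phi (mon u)) (subst_x v u) = cf p v ^+ nx u * delta ^+ ny u.
Proof.
elim: u => [|l u IH]; first by rewrite mon1 rmorph1 -mon1 cf_mon mulr1.
rewrite mon_cons rmorphM subst_x_cons cfM_uniq ?IH => [|u' v' e h1 h2]; last first.
  exact: wle_cat_eq (tri_img_le h1) (tri_mon_le h2) e.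
case: (letterP l) => -> /=; rewrite ?(tri_x tri) ?(tri_y tri) ?(tri_fix_z tri) ?cfD ?cfZ
  ?cf_var ?eqxx.
- case: (v =P _) => [ev|_]; first by move: lead_nx; rewrite ev.
  by rewrite mulr0 add0r !nE /= exprS mulrA.
- case: (eqVneq (cf b [:: ly]) 0) => [->|/(tri_z tri)[]//].
  by rewrite !nE /= mulr1 addr0 [in RHS]exprS mulrCA.
- by rewrite mul1r.
Qed.

End LeadingWord.

End Triangular.

End Leading.

(** * Words under substitution for x and under the swap of x and y *)

Section MoreWords.
Implicit Types (u v w s t : seq 'I_3) (l : 'I_3).
Local Open Scope nat_scope.

Lemma subst_x_x w : subst_x [:: lx] w = w.
Proof. by elim: w => //= l w IH; rewrite subst_x_cons IH; case: eqP => [->|]. Qed.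

Lemma subst_x_le v v' w : wle v v' -> wle (subst_x v w) (subst_x v' w).
Proof.
move=> le; elim: w => [|l w IH]; first exact: wle_refl.
by rewrite !subst_x_cons; apply: wle_cat IH; case: ifP => // _; apply: wle_refl.
Qed.

Lemma subst_x_lt v v' w : wlt v v' -> 0 < nx w -> wlt (subst_x v w) (subst_x v' w).
Proof.
move=> lt; elim: w => [|l w IH] //; rewrite nx_cons !subst_x_cons; case: eqP => _ h.
  by apply: wlt_cat => //; apply: subst_x_le; rewrite /wle lt orbT.
by apply: wlt_catl; apply: IH.
Qed.

(** The bound on [nx v] admits v = x, where the substitution is the identity and w itself is
    compared with its image. *)
Lemma subst_x_wtlt v v' w : wtlt v v' -> nx v' = 0 -> nx v <= 1 -> ny w = 0 -> 0 < nx w ->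
  wtlt (subst_x v w) (subst_x v' w).
Proof.
have [h1 h2 h3] := n_subst_x v w; have [h1' h2' h3'] := n_subst_x v' w.
by rewrite /wtlt h1 h2 h3 h1' h2' h3'; nia.
Qed.

Lemma x_prefix w : ny w = 0 -> 0 < nx w ->
  exists k t, w = nseq k lz ++ lx :: t /\ ny t = 0.
Proof.
elim: w => // l w IH; rewrite !nE; case: (letterP l) => -> //=.
  by move=> yw _; exists 0, w.
by move=> yw xw; case: IH => // k [t [-> yt]]; exists k.+1, t.
Qed.

Lemma n_nseq k : [/\ nx (nseq k lz) = 0, ny (nseq k lz) = 0 & nz (nseq k lz) = k].
Proof. by elim: k => //= k [h1 h2 h3]; rewrite !nE h1 h2 h3. Qed.

Lemma nseq_of_no_xy u : nx u = 0 -> ny u = 0 -> exists k, u = nseq k lz.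
Proof.
elim: u => [|l u IH]; first by exists 0.
rewrite !nE; case: (letterP l) => -> //= h1 h2; case: IH => // k ->; by exists k.+1.
Qed.

(** The smaller word has more letters z before its first x, or equally many and a smaller tail. Both
    survive putting the same v in place of that x, as v is z^r y followed by some word. *)
Lemma lexlt_first_x v k t j s : nx v = 0 -> 0 < ny v ->
  lexlt (nseq j lz ++ lx :: s) (nseq k lz ++ lx :: t) ->
  lexlt (nseq j lz ++ v ++ s) (nseq k lz ++ v ++ t).
Proof.
move=> v0 v1; have [r [v' ev]] := zprefix v1 v0; elim: j k => [|j IH] [|k] //=.
- by rewrite lexlt_cat2l.
- move=> _; rewrite ev -!catA.
  by rewrite [nseq j lz ++ nseq r lz ++ _]catA -nseqD; apply: (@lexlt_zprefix (j + r).+1); lia.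
- exact: IH.
Qed.

Lemma subseq_xy_cat u v : nx u = 0 -> ny v = 0 -> subseq [:: lx; ly] (u ++ v) = false.
Proof.
elim: u => [|l u IH] /=.
  by move=> _ yv; apply/negP => /mem_subseq /(_ ly); rewrite !inE orbT ny_mem yv => /(_ isT).
rewrite nx_cons => xu yv; case: eqP => [e|_]; last by apply: IH => //; lia.
by rewrite -e in xu.
Qed.

Lemma wmax (s : seq (seq 'I_3)) : s != [::] ->
  exists2 v, v \in s & forall u, u \in s -> wle u v.
Proof.
elim: s => // a [|b s] IH _.
  by exists a; rewrite ?inE // => u; rewrite inE => /eqP->; apply: wle_refl.
case: IH => // v vs vmax; case: (wlt_total a v) => h.
- exists v; first by rewrite inE vs orbT.
  by move=> u; rewrite inE => /orP[/eqP->|/vmax//]; rewrite h wle_refl.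
- exists v; first by rewrite inE vs orbT.
  by move=> u; rewrite inE => /orP[/eqP->|/vmax//]; rewrite /wle h orbT.
- exists a; first by rewrite inE eqxx.
  move=> u; rewrite inE => /orP[/eqP->|/vmax h']; first exact: wle_refl.
  by apply: wle_trans h' _; rewrite /wle h orbT.
Qed.

Definition swap_letter l : 'I_3 := if l == lx then ly else if l == ly then lx else lz.

Lemma swap_letterK : involutive swap_letter.
Proof. by move=> l; case: (letterP l) => ->. Qed.

Definition swap_word u := map swap_letter u.

Lemma swap_wordK : involutive swap_word.
Proof. by move=> u; rewrite /swap_word mapK //; apply: swap_letterK. Qed.

Lemma n_swap_word u : [/\ nx (swap_word u) = ny u,
  ny (swap_word u) = nx u & nz (swap_word u) = nz u].
Proof.
elim: u => //= l u [h1 h2 h3]; rewrite !nE h1 h2 h3; by case: (letterP l) => ->.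
Qed.

Lemma wtlt_swap_word u w : wtlt (swap_word u) (swap_word w) = wtlt u w.
Proof.
have [h1 h2 h3] := n_swap_word u; have [h1' h2' h3'] := n_swap_word w.
by rewrite /wtlt h1 h2 h3 h1' h2' h3' ![ny _ + _]addnC.
Qed.

Lemma wteq_swap_word u w : wteq (swap_word u) (swap_word w) = wteq u w.
Proof.
have [h1 h2 h3] := n_swap_word u; have [h1' h2' h3'] := n_swap_word w.
by rewrite /wteq h1 h2 h3 h1' h2' h3' ![ny _ + _]addnC.
Qed.

(** Without x the letters are z < y, and they become z < x. This is the only case in which the swap
    is known to respect ties of degree. *)
Lemma lexlt_swap_word u w : nx u = 0 -> nx w = 0 -> lexlt (swap_word u) (swap_word w) = lexlt u w.
Proof.
elim: u w => [|a u IH] [|b w] //=; rewrite !nx_cons.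
by case: (letterP a) => ->; case: (letterP b) => -> //= h1 h2; rewrite IH.
Qed.

End MoreWords.

(** * Dominant words and their images under a triangular map *)

Section Dominance.
Variables (K : fieldType) (A : word_algebra K).
Implicit Types (f g h p b : A) (u v w s t T : seq 'I_3) (c : K) (l : 'I_3).

Local Notation mon := (@wa_mon K A).
Local Notation cf := (@wa_coef K A).
Local Notation supp := (@wa_supp K A).
Local Notation var := (@var K A).

(** Ties of degree are restricted to words without y because [lexlt_subst_x] carries lexicographic
    comparisons through the substitution of v for x only between words in x and z. *)
Definition dominant_word h w : Prop :=
  [/\ cf h w != 0, ny w = 0%N, (0 < nx w)%N & forall u, cf h u != 0 ->
    [\/ u = w, wtlt u w | [/\ wteq u w, ny u = 0%N & lexlt u w]]].

(** If the largest word has no y, its degree in x and y is 0, and then so is that of every other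
    word. *)
Lemma leadP p : in_yz p -> in_z p \/ exists v, lead p v.
Proof.
move=> pyz; case: (boolP (supp p == [::])) => [/eqP e|/wmax[v vp vmax]].
  by left=> s; rewrite -mem_supp e.
rewrite mem_supp in vp; have {}vmax s : cf p s != 0 -> wle s v by rewrite -mem_supp => /vmax.
case: (posnP (ny v)) => yv; [left=> s ps | by right; exists v].
split; first exact: pyz.
by have /wle_wt := vmax _ ps; rewrite /wtlt /wteq yv (pyz _ ps) (pyz _ vp); lia.
Qed.

Section OneMap.
Variables (phi : {lrmorphism A -> A}) (alpha delta : K) (p b h : A) (w : seq 'I_3).
Hypotheses (tri : triangular phi alpha delta p b) (hw : dominant_word h w).

Lemma dominant_nx u : cf h u != 0 -> (nx u + ny u <= nx w)%N.
Proof.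
have [_ yw _ Dw] := hw; move/Dw => -[->|h1|[h1 _ _]]; first by rewrite yw addn0.
  by move: h1; rewrite /wtlt yw; lia.
by move: h1; rewrite /wteq yw; lia.
Qed.

(** No word of h has more than [nx w] letters x and y together, and x never increases. So a word
    producing w has as many x as w and no y, keeps all of them, and is w. *)
Lemma dominant_coef : cf (phi h) w = cf h w * alpha ^+ nx w.
Proof.
have [_ yw xw Dw] := hw; rewrite -(tri_mon_diag tri yw).
apply: cf_tri_uniq => u hu huw; have le := dominant_nx hu; have le' := tri_nx tri huw.
by have [|_ e] := tri_keep_x tri huw; [lia | symmetry; apply: e; lia].
Qed.

Lemma dominant_tri_in_z : in_z p -> dominant_word (phi h) w.
Proof.
move=> pz; have [hw0 yw xw Dw] := hw; split=> //.
  by rewrite dominant_coef mulf_neq0 // expf_neq0 // (tri_alpha tri).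
(* With p and b both in K[z], every replacement of a letter x or y lowers the degree in x and y. *)
have lin u T : cf (phi (mon u)) T != 0 -> T = u \/ (nx T + ny T < nx u + ny u)%N.
  elim: u T => [|l u IH] T; first by move/tri_mon_nil->; left.
  case/tri_mon_cons => s [T' [-> hs /IH h']]; rewrite !nE.
  case: (tri_img_supp tri hs) => [->|[-> /pz [s1 s2]]|[-> /(tri_z tri) [s1 s2]]].
  - by case: h' => [->|lt]; [left | right; rewrite !nE; lia].
  - by right; rewrite s1 s2 /=; case: h' => [->|]; lia.
  - by right; rewrite s1 s2 /=; case: h' => [->|]; lia.
move=> T /cf_tri_neq0[u [hu /lin[->|lt]]]; first exact: Dw.
by apply: Or32; have := dominant_nx hu; rewrite /wtlt yw; lia.
Qed.

Section Lead.
Variable v : seq 'I_3.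
Hypothesis pv : lead p v.

Lemma dominant_subst_x u : cf h u != 0 -> u != w -> wlt (subst_x v u) (subst_x v w).
Proof.
have [_ yw xw Dw] := hw; have xv := lead_nx tri pv; have yv := lead_ny pv; move=> hu /eqP ne.
have [h1 h2 h3] := n_subst_x v u; have [h1' h2' h3'] := n_subst_x v w.
have le := dominant_nx hu.
case: (Dw _ hu) => [//|lt|[e yu lt]].
  apply/orP; left; rewrite /wtlt h1 h2 h3 h1' h2' h3' xv yw.
  by move: lt; rewrite /wtlt yw; nia.
have en : nx u = nx w by move: e; rewrite /wteq yu yw; lia.
have ez : nz u = nz w by move: e; rewrite /wteq yu yw; lia.
apply/orP; right; rewrite lexlt_subst_x // andbT.
by rewrite /wteq h1 h2 h3 h1' h2' h3' en ez yu yw !eqxx.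
Qed.

Lemma dominant_subst_x_le u : cf h u != 0 -> wle (subst_x v u) (subst_x v w).
Proof.
move=> hu; case: (eqVneq u w) => [->|ne]; first exact: wle_refl.
by rewrite /wle dominant_subst_x ?orbT.
Qed.

Lemma dominant_max T : cf (phi h) T != 0 -> wle T (subst_x v w).
Proof.
case/cf_tri_neq0 => u [hu hT]; apply: wle_trans _ (dominant_subst_x_le hu).
exact: (tri_mon_le tri pv hT).
Qed.

Lemma dominant_max_coef : cf (phi h) (subst_x v w) != 0.
Proof.
have [hw0 yw xw Dw] := hw; have xv := lead_nx tri pv; have yv := lead_ny pv.
rewrite (cf_tri_uniq (w := w)) => [|u hu hT]; last first.
  apply/eqP/negbNE/negP => ne; have := dominant_subst_x hu ne.
  have le := tri_mon_le tri pv hT.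
  by move/(wle_lt_trans le); rewrite wlt_irr.
by rewrite (tri_mon_lead tri pv) !mulf_neq0 ?expf_neq0 //; [case: pv | exact: tri_delta tri].
Qed.

Lemma dominant_max_x T : v != [:: ly] -> cf (phi h) T != 0 ->
  wtlt T (subst_x v w) \/ wteq T (subst_x v w) /\ nx T = 0%N.
Proof.
move=> vy hT; have /wle_wt/orP[lt|e] := dominant_max hT; first by left.
right; split=> //; case: (posnP (nx T)) => // xT.
case/cf_tri_neq0: hT => u [hu hT].
have lt := tri_mon_wtlt tri pv vy hT xT.
by have /wle_wt := dominant_subst_x_le hu; move: lt e; rewrite /wtlt /wteq; lia.
Qed.

(* The word of the numerator is w with its first x replaced by v. *)
Lemma dominant_ratio : exists k t, [/\ w = nseq k lz ++ lx :: t &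
  cf (phi h) (nseq k lz ++ v ++ t) / cf (phi h) w = cf p v / alpha].
Proof.
have [hw0 yw xw Dw] := hw; have xv := lead_nx tri pv; have yv := lead_ny pv;
  have [k [t [ew yt]]] := x_prefix yw xw.
exists k, t; split=> //; rewrite dominant_coef.
rewrite (cf_tri_uniq (w := w)) => [|u hu hT]; last first.
  have [k1 k2 k3] := n_nseq k; have le := dominant_nx hu.
  have nT : nx (nseq k lz ++ v ++ t) = (nx w).-1 by rewrite ew !nE k1 xv.
  have yT : ny (nseq k lz ++ v ++ t) = ny v by rewrite !nE k2 yt; lia.
  have zT : nz (nseq k lz ++ v ++ t) = (nz w + nz v)%N by rewrite ew !nE /=; lia.
  have leT := tri_nx tri hT.
  case: (ltngtP (nx u) (nx w)) => [lt|gt|en]; [| by lia |].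
    (* One x is already missing from u, so the others are all kept and u is the word z^k v t itself.
       But that word contains y and is not lighter than w, against dominance. *)
    have [|leu eu] := tri_keep_x tri hT; first by lia.
    have Tu : nseq k lz ++ v ++ t = u by apply: eu; lia.
    case: (Dw _ hu) => [->//|lt'|[_ yu _]]; last by rewrite -Tu yT in yu; lia.
    by move: lt'; rewrite -Tu /wtlt nT yT zT yw; lia.
  have yu : ny u = 0%N by lia.
  have [|u1 [s [u2 [eu eT ps]]]] := tri_drop_x tri hT yu; first by lia.
  have [xs ys1 ys2] : [/\ nx s = 0, ny u1 = 0 & ny u2 = 0]%N.
    by split; [exact: (tri_yz tri ps) | move: yu; rewrite eu !nE; lia ..].
  have ys : (0 < ny s)%N by move: yT; rewrite eT !nE; lia.
  (* In z^k v t no x precedes a y, so the replaced x is the first x of u. *)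
  have xu1 : nx u1 = 0%N.
    apply/eqP/negbNE/negP => xu1.
    have := @subseq_xy_cat (nseq k lz ++ v) t; rewrite -catA eT !nE k1 xv => /(_ erefl yt)/negP.
    case; rewrite -[[:: lx; ly]]/([:: lx] ++ [:: ly]); apply: cat_subseq.
      by rewrite sub1seq nx_mem; lia.
    by rewrite sub1seq mem_cat ny_mem ys.
  have [j ej] := nseq_of_no_xy xu1 ys1.
  (* If u differs from w, then even with the largest word v of p put for its first x, it yields a
     word below z^k v t. *)
  apply/eqP/negbNE/negP => ne; have le1 := (let: And3 _ _ vmax := pv in vmax _ ps).
  have [j1 j2 j3] := n_nseq j.
  have nU : nx (nseq j lz ++ v ++ u2) = (nx w).-1.
    by rewrite -en eu ej !nE j1 xv.
  have yU : ny (nseq j lz ++ v ++ u2) = ny v by rewrite !nE j2 ys2; lia.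
  have zU : nz (nseq j lz ++ v ++ u2) = (nz u + nz v)%N by rewrite eu ej !nE /=; lia.
  have lt : wlt (nseq j lz ++ v ++ u2) (nseq k lz ++ v ++ t).
    rewrite /wlt /wtlt /wteq nT yT zT nU yU zU.
    case: (Dw _ hu) => [e|lt|[e _ lt]]; first by rewrite e eqxx in ne.
      by apply/orP; left; move: lt; rewrite /wtlt; lia.
    apply/orP; right; rewrite lexlt_first_x ?andbT //; last by rewrite -ej -eu -ew.
    by move: e; rewrite /wteq; lia.
  have := wle_lt_trans (wle_catl (nseq j lz) (wle_catr u2 le1)) lt.
  by rewrite eT ej wlt_irr.
(* The numerator keeps one x less than w does, so exactly one power of alpha remains in the
   quotient. *)
rewrite {2}ew (tri_mon_replace tri pv) // ew !nE.
have [-> _ _] := n_nseq k; rewrite /= add0n add1n exprS.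
have := hw0; rewrite ew => hw1; have a1 := tri_alpha tri; set q := alpha ^+ _.
have q0 : q != 0 by rewrite expf_neq0.
by field; rewrite q0 a1 hw1.
Qed.

End Lead.
End OneMap.
End Dominance.

(** * Lowering an element of the orbit of x *)

Section Reduction.
Variables (K : fieldType) (A : word_algebra K).
Implicit Types (f g h p b q : A) (u v w s t T : seq 'I_3) (a c : K) (l : 'I_3).
Implicit Types phi psi : {lrmorphism A -> A}.

Local Notation mon := (@wa_mon K A).
Local Notation cf := (@wa_coef K A).
Local Notation supp := (@wa_supp K A).
Local Notation var := (@var K A).

Lemma lrmorph_ext_on (L : pred 'I_3) phi psi g :
  (forall l, L l -> phi (var l) = psi (var l)) ->
  (forall s, cf g s != 0 -> all L s) -> phi g = psi g.
Proof.
move=> e gL; rewrite (fa_expand g) !linear_sum; apply: eq_big_seq => w.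
rewrite mem_supp => /gL wL; rewrite !linearZ /=; congr (_ *: _).
elim: w wL => [|l w IH] /=; first by rewrite mon1 !rmorph1.
by case/andP=> /e el /IH ew; rewrite mon_cons !rmorphM /= el ew.
Qed.

Lemma in_yzP g : in_yz g -> forall s, cf g s != 0 -> all (predC1 lx) s.
Proof.
by move=> gyz s /gyz sx; apply/allP => l ls /=; apply: contraTneq ls => ->; rewrite nx_mem sx.
Qed.

Lemma in_zP g : in_z g -> forall s, cf g s != 0 -> all (pred1 lz) s.
Proof.
move=> gz s /gz[sx sy]; apply/allP => l; case: (letterP l) => -> //.
  by rewrite nx_mem sx.
by rewrite ny_mem sy.
Qed.

Lemma lrmorph_ext_yz phi psi g : phi (var ly) = psi (var ly) ->
  phi (var lz) = psi (var lz) -> in_yz g -> phi g = psi g.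
Proof.
move=> ey ez /in_yzP; apply: lrmorph_ext_on => l /=.
by case: (letterP l) => ->.
Qed.

Lemma lrmorph_ext_z phi psi g :
  phi (var lz) = psi (var lz) -> in_z g -> phi g = psi g.
Proof. by move=> ez /in_zP; apply: lrmorph_ext_on => l /= /eqP->. Qed.

Lemma in_yzD g h : in_yz g -> in_yz h -> in_yz (g + h).
Proof. by move=> gP hP s; rewrite cfD => /addr_neq0[/gP|/hP]. Qed.

Lemma in_zD g h : in_z g -> in_z h -> in_z (g + h).
Proof. by move=> gP hP s; rewrite cfD => /addr_neq0[/gP|/hP]. Qed.

Lemma cfZ_neq0 c g s : cf (c *: g) s != 0 -> cf g s != 0.
Proof. by rewrite cfZ mulf_eq0 negb_or => /andP[]. Qed.

Lemma in_yzZ c g : in_yz g -> in_yz (c *: g).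
Proof. by move=> gP s /cfZ_neq0/gP. Qed.

Lemma in_zZ c g : in_z g -> in_z (c *: g).
Proof. by move=> gP s /cfZ_neq0/gP. Qed.

Lemma in_z0 : in_z (0 : A).
Proof. by move=> s; rewrite cf0 eqxx. Qed.

Lemma in_z_yz g : in_z g -> in_yz g.
Proof. by move=> gP s /gP[]. Qed.

Lemma in_yz_var_y : in_yz (var ly).
Proof. by move=> s; rewrite cf_var; case: (s =P _) => [->|] //; rewrite eqxx. Qed.

Lemma in_yz_mon v : nx v = 0%N -> in_yz (mon v).
Proof. by move=> xv s; rewrite cf_mon; case: (v =P s) => [<-|] //; rewrite eqxx. Qed.

Hint Resolve in_z0 in_z_yz in_yz_var_y in_yzD in_zD in_yzZ in_zZ : core.

Lemma tri_in_yz phi alpha delta p b g :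
  triangular phi alpha delta p b -> in_yz g -> in_yz (phi g).
Proof.
move=> tri gP T /cf_tri_neq0[u [/gP xu /(tri_nx tri)]]; lia.
Qed.

Lemma fix_in_z phi g : phi (var lz) = var lz -> in_z g -> phi g = g.
Proof. exact: (@lrmorph_ext_z phi idfun). Qed.

Definition is_tri phi := exists alpha delta p b, triangular phi alpha delta p b.

Lemma tri_comp phi psi alpha delta p b alpha' delta' p' b' :
  triangular phi alpha delta p b -> triangular psi alpha' delta' p' b' ->
  triangular (phi \o psi) (alpha' * alpha) (delta' * delta)
    (alpha' *: p + phi p') (delta' *: b + b').
Proof.
move=> t t'; split.
- by rewrite mulf_neq0 ?(tri_alpha t) ?(tri_alpha t').
- by rewrite mulf_neq0 ?(tri_delta t) ?(tri_delta t').
- exact: in_yzD (in_yzZ (tri_yz t)) (tri_in_yz t (tri_yz t')).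
- exact: in_zD (in_zZ (tri_z t)) (tri_z t').
- by rewrite /= (tri_x t') linearD linearZ /= (tri_x t) scalerDr scalerA addrA.
- rewrite /= (tri_y t') linearD linearZ /= (tri_y t) scalerDr scalerA addrA.
  by rewrite (fix_in_z (tri_fix_z t) (tri_z t')).
- by rewrite /= (tri_fix_z t') (tri_fix_z t).
Qed.

Lemma is_tri_comp phi psi : is_tri phi -> is_tri psi -> is_tri (phi \o psi).
Proof.
by case=> [? [? [? [? t]]]] [? [? [? [? t']]]]; do 4 eexists; apply: tri_comp t t'.
Qed.

Definition tri_sub alpha delta p b : {lrmorphism A -> A} :=
  sub (fun l => if l == lx then alpha *: var lx + p
                else if l == ly then delta *: var ly + b else var lz).

Global Arguments tri_sub : simpl never.

Lemma tri_subP alpha delta p b : alpha != 0 -> delta != 0 -> in_yz p -> in_z b ->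
  triangular (tri_sub alpha delta p b) alpha delta p b.
Proof. by move=> *; split; rewrite // /tri_sub /= sub_var. Qed.

Lemma tri_inv phi : is_tri phi -> exists psi, [/\ is_tri psi, cancel phi psi & cancel psi phi].
Proof.
case=> alpha [delta [p [b t]]].
have [a0 d0 pP bP] := And4 (tri_alpha t) (tri_delta t) (tri_yz t) (tri_z t).
(* The inverse sends x to alpha^-1 (x - psi(p)), which refers to the inverse psi itself. Since p
   involves only y and z, [psi1], the inverse on these two letters, can be used instead. *)
pose psi1 := tri_sub 1 delta^-1 0 (- delta^-1 *: b).
have t1 : triangular psi1 1 delta^-1 0 (- delta^-1 *: b).
  by apply: tri_subP; rewrite ?oner_neq0 ?invr_eq0 //; auto.
pose p' := - alpha^-1 *: psi1 p.
have t2 : triangular (tri_sub alpha^-1 delta^-1 p' (- delta^-1 *: b))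
    alpha^-1 delta^-1 p' (- delta^-1 *: b).
  by apply: tri_subP; rewrite ?invr_eq0 //; [exact: in_yzZ (tri_in_yz t1 pP) | auto].
set psi := tri_sub _ _ _ _ in t2; exists psi; split.
- by do 4 eexists; apply: t2.
- apply: (@lrmorph_ext _ _ (psi \o phi) idfun) => l /=; case: (letterP l) => ->.
  + rewrite (tri_x t) linearD linearZ /= (tri_x t2).
    rewrite (@lrmorph_ext_yz psi psi1 p) ?(tri_y t1) ?(tri_y t2) ?(tri_fix_z t1) ?(tri_fix_z t2) //.
    by rewrite scalerDr !scalerA mulrN divff // scaleN1r scale1r subrK.
  + rewrite (tri_y t) linearD linearZ /= (tri_y t2) (fix_in_z (tri_fix_z t2) bP).
    by rewrite scalerDr !scalerA mulrN divff // scaleN1r scale1r subrK.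
  + by rewrite (tri_fix_z t) (tri_fix_z t2).
- apply: (@lrmorph_ext _ _ (phi \o psi) idfun) => l /=; case: (letterP l) => ->.
  + rewrite (tri_x t2) linearD linearZ /= (tri_x t) linearZ /=.
    have -> : phi (psi1 p) = p.
      apply: (@lrmorph_ext_yz (phi \o psi1) idfun) => //=.
        rewrite (tri_y t1) linearD linearZ /= (tri_y t) (fix_in_z (tri_fix_z t)); last by auto.
        by rewrite scalerDr scalerA mulVf // scale1r scaleNr addrK.
      by rewrite (tri_fix_z t1) (tri_fix_z t).
    by rewrite scalerDr scalerA mulVf // scale1r scaleNr addrK.
  + rewrite (tri_y t2) linearD linearZ /= (tri_y t) (fix_in_z (tri_fix_z t)); last by auto.
    by rewrite scalerDr scalerA mulVf // scale1r scaleNr addrK.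
  + by rewrite (tri_fix_z t2) (tri_fix_z t).
Qed.

Definition swap_xy : {lrmorphism A -> A} := sub (fun l => var (swap_letter l)).

Global Arguments swap_xy : simpl never.

Lemma swap_xy_var l : swap_xy (var l) = var (swap_letter l). Proof. by rewrite /swap_xy /=
  sub_var. Qed.

Lemma swap_xyK : involutive swap_xy.
Proof.
by apply: (@lrmorph_ext _ _ (swap_xy \o swap_xy) idfun) => l /=; rewrite !swap_xy_var swap_letterK.
Qed.

Lemma swap_xy_mon u : swap_xy (mon u) = mon (swap_word u).
Proof.
elim: u => [|l u IH]; first by rewrite !mon1 rmorph1.
by rewrite mon_cons rmorphM /= IH swap_xy_var -mon_cons.
Qed.

Lemma cf_swap_xy g T : cf (swap_xy g) T = cf g (swap_word T).
Proof.
elim/fa_ind: g => [|c w g IH]; first by rewrite linear0 !cf0.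
rewrite linearD linearZ !cfD !cfZ /= IH swap_xy_mon !cf_mon; congr (_ * _%:R + _).
by rewrite -[X in _ == X]swap_wordK (inj_eq (can_inj swap_wordK)).
Qed.

(** For p in K<y,z> this is membership in K y + K[z]. The triangular map is then linear in x and y
    up to terms in K[z], and swaps around it can be merged. *)
Definition linear_in_y p := forall s, cf p s != 0 -> ny s = 0%N \/ s = [:: ly].

Inductive xdominant : A -> Prop :=
| xdominant_x : xdominant (var lx)
| xdominant_swap phi alpha delta p b h : triangular phi alpha delta p b -> ~ linear_in_y p ->
    xdominant h -> xdominant (swap_xy (phi h)).

(** The words in y and z that do not exceed y are y and the words without y, so a leading word y
    would make p linear in y. *)
Lemma nonlin_lead p : in_yz p -> ~ linear_in_y p -> exists2 v, lead p v & v != [:: ly].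
Proof.
move=> pyz nl; case: (leadP pyz) => [pz|[v pv]]; first by case: nl => s /pz[_ ->]; left.
exists v => //; apply/eqP => ev; case: nl => s ps; case: pv => _ _ /(_ s ps).
rewrite ev /wle /wlt => /or3P[/eqP->|lt|/andP[/wteq_size sz]]; first by right.
  by left; move: lt; rewrite /wtlt !nE (pyz _ ps) /=; lia.
move=> _; case: s sz ps => [|l []] //= _ /pyz; rewrite !nE.
by case: (letterP l) => -> //= _; [right | left].
Qed.

Lemma dominant_x : dominant_word (var lx) [:: lx].
Proof.
split=> //; first by rewrite cf_var eqxx oner_neq0.
by move=> u; rewrite cf_var; case: (u =P _) => [->|]; [move=> _; apply: Or31 | rewrite eqxx].
Qed.

(** A word of T h tied in degrees with the largest one has no x; after the swap it has no y and
    compares as before. *)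
Lemma dominant_swap phi alpha delta p b h w v : triangular phi alpha delta p b ->
  dominant_word h w -> lead p v -> v != [:: ly] ->
    dominant_word (swap_xy (phi h)) (swap_word (subst_x v w)).
Proof.
move=> t hw pv vy; have [n1 n2 n3] := n_subst_x v w; have [m1 m2 m3] := n_swap_word (subst_x v w).
have xv := lead_nx t pv; have yv := lead_ny pv; have [_ yw xw _] := hw.
split.
- by rewrite cf_swap_xy swap_wordK (dominant_max_coef t hw pv).
- by rewrite m2 n1 xv muln0.
- by rewrite m1 n2; nia.
move=> u; rewrite cf_swap_xy => hu; have le := dominant_max t hw pv hu.
case: (dominant_max_x t hw pv vy hu) => [lt|[e xu]].
  by apply: Or32; rewrite -wtlt_swap_word swap_wordK.
case/orP: le => [/eqP<-|]; first by apply: Or31; rewrite swap_wordK.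
have nlt : wtlt (swap_word u) (subst_x v w) = false by move: e; rewrite /wteq /wtlt; lia.
rewrite /wlt nlt e /= => lt; apply: Or33; split.
- by rewrite -wteq_swap_word swap_wordK.
- by have [<- _ _] := n_swap_word u.
- by rewrite -[u]swap_wordK lexlt_swap_word // n1 xv muln0.
Qed.

Lemma xdominant_dominant_word h : xdominant h -> exists w, dominant_word h w.
Proof.
elim=> [|phi alpha delta p b {}h t nl _ [w hw]]; first by exists [:: lx]; apply: dominant_x.
have [v pv vy] := nonlin_lead (tri_yz t) nl.
by exists (swap_word (subst_x v w)); exact: (dominant_swap t hw pv vy).
Qed.

(** A comparison of largest words, phrased through a bounding word of f so that g = 0 lies below
    every nonzero f. *)
Definition less g f := exists2 u, cf f u != 0 & forall u', cf g u' != 0 -> wlt u' u.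

Definition stepx v c : {lrmorphism A -> A} := tri_sub 1 1 (- c *: mon v) 0.

Lemma stepxP v c : nx v = 0%N -> triangular (stepx v c) 1 1 (- c *: mon v) 0.
Proof.
by move=> xv; apply: tri_subP; rewrite ?oner_neq0 //; exact: in_yzZ (in_yz_mon xv).
Qed.

(** The step fixes p and subtracts alpha c v from alpha x, whence the division of the coefficient by
    alpha. *)
Lemma step_tri phi alpha delta p b v :
  triangular phi alpha delta p b -> nx v = 0%N ->
  triangular (stepx v (cf p v / alpha) \o phi) alpha delta (p - cf p v *: mon v) b.
Proof.
move=> t xv; have ts := stepxP (cf p v / alpha) xv; have := tri_comp ts t.
rewrite !mulr1 scaler0 add0r scalerA mulrN [alpha * _]mulrC divfK ?(tri_alpha t) // scaleNr.
have -> : stepx v (cf p v / alpha) p = p; last by rewrite [- _ + p]addrC.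
apply: (@lrmorph_ext_yz _ idfun p _ _ (tri_yz t)); last exact: tri_fix_z ts.
by rewrite (tri_y ts) scale1r addr0.
Qed.

Lemma lead_sub p v : lead p v -> forall s, cf (p - cf p v *: mon v) s != 0 ->
  cf p s != 0 /\ wlt s v.
Proof.
case=> _ _ vmax s; rewrite cfB cfZ cf_mon; case: (v =P s) => [<-|ne].
  by rewrite mulr1 subrr eqxx.
rewrite mulr0 subr0 => ps; split=> //; case/orP: (vmax _ ps) => // /eqP e.
by case: ne.
Qed.

(** The step removes the leading term of p. The rest has a smaller leading word, or lies in K[z]; in
    the latter case w itself is the largest word, as if x were substituted for x. *)
Lemma less_stepx phi alpha delta p b h w v : triangular phi alpha delta p b ->
  dominant_word h w -> lead p v -> less (stepx v (cf p v / alpha) (phi h)) (phi h).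
Proof.
move=> t hw pv; have xv := lead_nx t pv; have [_ yw xw Dw] := hw.
have t' := step_tri t xv; have sub_lt := lead_sub pv.
exists (subst_x v w) => [|u' hu']; first exact: (dominant_max_coef t hw pv).
case: (leadP (tri_yz t')) => [pz|[v' pv']].
  apply: (@wle_lt_trans _ w); last by rewrite -{1}[w]subst_x_x subst_x_lt // (x_lt_v t pv).
  have [_ _ _ Dw'] := dominant_tri_in_z t' hw pz.
  case: (Dw' _ hu') => [->|lt|[e _ lt]]; rewrite /wle ?eqxx // /wlt ?lt ?e ?orbT //.
apply: wle_lt_trans (dominant_max t' hw pv' hu') (subst_x_lt _ xw).
by case: pv' => /sub_lt[].
Qed.

Lemma less_stepx_swap phi alpha delta p b h w v : triangular phi alpha delta p b ->
  dominant_word h w -> lead p v -> v != [:: ly] ->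
  less (swap_xy (stepx v (cf p v / alpha) (phi h))) (swap_xy (phi h)).
Proof.
move=> t hw pv vy; have xv := lead_nx t pv; have [_ yw xw Dw] := hw.
have t' := step_tri t xv; have sub_lt := lead_sub pv.
have [n1 _ _] := n_subst_x v w.
exists (swap_word (subst_x v w)) => [|u'];
  first by rewrite cf_swap_xy swap_wordK (dominant_max_coef t hw pv).
rewrite cf_swap_xy -[u']swap_wordK; move: (swap_word u') => {}u' hu'; rewrite swap_wordK in hu'.
have small T : wtlt T (subst_x v w) -> wlt (swap_word T) (swap_word (subst_x v w)).
  by rewrite -wtlt_swap_word /wlt => ->.
have wv := x_wtlt_v t pv vy.
case: (leadP (tri_yz t')) => [pz|[v' pv']].
  apply: small; have ltw : wtlt w (subst_x v w).
    by rewrite -{1}[w]subst_x_x subst_x_wtlt.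
  have [_ _ _ Dw'] := dominant_tri_in_z t' hw pz; move: ltw.
  by case: (Dw' _ hu') => [->//|lt|[e _ lt]]; [move: lt | move: e]; rewrite /wtlt /wteq; lia.
have [_ v'v] := sub_lt v' (let: And3 v0 _ _ := pv' in v0).
have xv' := lead_nx t' pv'; have [n1' _ _] := n_subst_x v' w.
have lt := subst_x_lt v'v xw; have le := dominant_max t' hw pv' hu'.
(* For v' = y, words tied with the new largest word may contain x; but v is heavier than y, so the
   degrees alone decide. *)
case: (eqVneq v' [:: ly]) => v'y.
  apply: small; have ltw : wtlt (subst_x v' w) (subst_x v w).
    by apply: subst_x_wtlt; rewrite ?v'y // -v'y; move: wv; rewrite v'y /wtlt.
  by move: (wle_wt le) ltw; rewrite /wtlt /wteq; lia.
(* A word tied with the old largest word is also tied with the new one, hence free of x, and the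
   swap respects the lexicographic comparison. *)
have xu' : wteq u' (subst_x v w) -> nx u' = 0%N.
  move=> e; case: (dominant_max_x t' hw pv' v'y hu') => [lt'|[]//].
  have le' : wle (subst_x v' w) (subst_x v w) by rewrite /wle lt orbT.
  by move: (wle_wt le') lt' e; rewrite /wtlt /wteq; lia.
case/orP: (wle_lt_trans le lt) => [/small//|/andP[e lx']].
by rewrite /wlt wteq_swap_word e lexlt_swap_word ?lx' ?orbT ?xu' // n1 xv muln0.
Qed.

Definition terminal f := exists alpha beta b,
  [/\ (alpha != 0) || (beta != 0), in_z b & f = alpha *: var lx + beta *: var ly + b].

Definition omega f :=
  (exists phi h, [/\ is_tri phi, xdominant h & f = phi h]) \/
  (exists delta b, [/\ delta != 0, in_z b & f = delta *: var ly + b]).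

(** It mentions only data visible in f, not the factorization T h, so the pairs (v, c) lie in a
    finite list computable from f. *)
Definition good_step f v c :=
  exists w u s t, [/\ nx v = 0%N, cf f w != 0, cf f u != 0, u = s ++ v ++ t & c = cf f u / cf f w].

Lemma good_stepP phi alpha delta p b h w v : triangular phi alpha delta p b ->
  dominant_word h w -> lead p v -> good_step (phi h) v (cf p v / alpha).
Proof.
move=> t hw pv; have [k [s [_ e]]] := dominant_ratio t hw pv.
exists w, (nseq k lz ++ v ++ s), (nseq k lz), s; split=> //.
- exact: (lead_nx t pv).
- have [h0 _ _ _] := hw; rewrite (dominant_coef t hw) mulf_neq0 // expf_neq0 //;
  exact: (tri_alpha t).
- apply: contraTneq (tri_alpha t) => e0; move: e; rewrite e0 mul0r => /esym/eqP.
  by case: pv => v0 _ _; rewrite mulf_eq0 (negbTE v0) invr_eq0 /= => ->.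
Qed.

Lemma cf_lin_y beta b : in_z b -> cf (beta *: var ly + b) [:: ly] = beta.
Proof.
move=> bz; rewrite cfD cfZ cf_var eqxx mulr1.
by case: (eqVneq (cf b [:: ly]) 0) => [->|/bz[]//]; rewrite addr0.
Qed.

Lemma linear_in_yP p : in_yz p -> linear_in_y p -> exists beta q, in_z q /\ p = beta *: var ly + q.
Proof.
move=> pyz pl; exists (cf p [:: ly]), (p - cf p [:: ly] *: var ly).
split; last by rewrite addrC subrK.
move=> s; rewrite cfB cfZ cf_var; case: (s =P _) => [->|ne].
  by rewrite mulr1 subrr eqxx.
by rewrite mulr0 subr0 => ps; split; [exact: pyz | case: (pl _ ps)].
Qed.

Lemma omega_reduce f : omega f -> [\/ terminal f,
  exists v c, good_step f v c /\ less (stepx v c f) f |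
  exists v c, good_step (swap_xy f) v c /\ less (swap_xy (stepx v c (swap_xy f))) f].
Proof.
case=> [[phi [h [[alpha [delta [p [b t]]]] hd ->]]]|[delta [b [d0 bz ->]]]]; last first.
  by apply: Or31; exists 0, delta, b; rewrite d0 orbT scale0r add0r.
case: (leadP (tri_yz t)) => [pz|[v pv]]; last first.
  have [w hw] := xdominant_dominant_word hd; apply: Or32; exists v, (cf p v / alpha).
  by split; [exact: (good_stepP t hw pv) | exact: (less_stepx t hw pv)].
case: hd => [|phi2 alpha2 delta2 p2 b2 h2 t2 nl hd2].
  by apply: Or31; exists alpha, 0, p; rewrite (tri_alpha t) scale0r addr0 (tri_x t).
(* Here p and b both lie in K[z], so conjugating T by the swap gives again a triangular map, with p
   and b exchanged. The outer swap can thus be moved to the left, and S f has the form psi T2 h2. *)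
have [psi psiE] : exists psi : {lrmorphism A -> A}, psi =1 swap_xy \o (phi \o swap_xy).
  by exists (swap_xy \o (phi \o swap_xy)).
have tp : triangular psi delta alpha b p.
  split; rewrite ?(tri_alpha t) ?(tri_delta t) //; first exact: in_z_yz (tri_z t).
  - rewrite psiE /= swap_xy_var (tri_y t) linearD linearZ /= swap_xy_var.
    by rewrite (fix_in_z _ (tri_z t)) // swap_xy_var.
  - rewrite psiE /= swap_xy_var (tri_x t) linearD linearZ /= swap_xy_var.
    by rewrite (fix_in_z _ pz) // swap_xy_var.
  - by rewrite psiE /= swap_xy_var (tri_fix_z t) swap_xy_var.
have t' := tri_comp tp t2; have [v2 pv2 v2y] := nonlin_lead (tri_yz t2) nl.
(* The leading word v2 of p2 survives: psi maps y to alpha y + p with p in K[z], so it can only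
   lower words in y and z or keep them, and the summand alpha2 b contains no y. Hence the new
   polynomial is not linear in y. *)
have pv : exists2 v, lead (alpha2 *: b + psi p2) v & v != [:: ly].
  have yv2 := lead_ny pv2; have xv2 := lead_nx t2 pv2.
  apply: nonlin_lead (tri_yz t') _ => lp.
  have : cf (alpha2 *: b + psi p2) v2 != 0; last first.
    by case/lp => e; [rewrite e in yv2 | rewrite e eqxx in v2y].
  rewrite cfD cfZ; case: (eqVneq (cf b v2) 0) => [->|/(tri_z t)[_ e]]; last by rewrite e in yv2.
  have [v20 _ v2max] := pv2.
  have tri_le u T : nx u = 0%N -> cf (psi (mon u)) T != 0 -> wle T u.
    elim: u T => [|l u IH] T; first by move=> _ /tri_mon_nil->; apply: wle_refl.
    rewrite nx_cons => xu /tri_mon_cons[s [T' [-> hs /IH le]]].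
    rewrite -cat1s; apply: wle_cat; last by apply: le; lia.
    case: (tri_img_supp tp hs) xu => [->|[->]//|[-> /pz[s1 s2]] _]; first by rewrite wle_refl.
    by rewrite /wle /wlt /wtlt s1 s2 orbT.
  rewrite mulr0 add0r (cf_tri_uniq (w := v2)) => [|u pu hu]; last first.
    by apply: wle_anti (v2max _ pu) (tri_le _ _ _ hu); apply: (tri_yz t2).
  rewrite mulf_neq0 //.
  suff diag : forall u, nx u = 0%N -> cf (psi (mon u)) u = alpha ^+ ny u.
    by rewrite diag // expf_neq0 // (tri_alpha t).
  elim=> [_|l u IH]; first by rewrite mon1 rmorph1 -mon1 cf_mon.
  rewrite !nE => xu; rewrite mon_cons rmorphM -cat1s cfM_uniq => [|u' v' e c1 c2]; last first.
    have le1 : wle u' [:: l].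
      by apply: tri_le; [rewrite !nE; lia | rewrite -[mon _]/(var l)].
    by apply: wle_cat_eq le1 (tri_le u v' _ c2) e; lia.
  rewrite IH; last by lia.
  case: (letterP l) xu => -> //= _; last by rewrite (tri_fix_z tp) cf_var eqxx mul1r.
  by rewrite (tri_y tp) cf_lin_y // exprS.
case: pv => v pv vy; have [w hw] := xdominant_dominant_word hd2; apply: Or33.
have e : phi (swap_xy (phi2 h2)) = swap_xy ((psi \o phi2) h2) by rewrite /= psiE /= !swap_xyK.
rewrite e swap_xyK; exists v, (cf (alpha2 *: b + psi p2) v / (alpha2 * delta)); split.
  exact: (good_stepP t' hw pv).
exact: (less_stepx_swap t' hw pv vy).
Qed.

End Reduction.

(** * Stability under the z-tame group *)

Section Orbit.
Variables (K : fieldType) (A : word_algebra K).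
Implicit Types (f g h p b q : A) (u v w s t T : seq 'I_3) (a c : K) (l : 'I_3).
Implicit Types phi psi : {lrmorphism A -> A}.

Local Notation mon := (@wa_mon K A).
Local Notation cf := (@wa_coef K A).
Local Notation var := (@var K A).
Local Notation swap_xy := (@swap_xy K A).

Lemma omega_tri phi f : is_tri phi -> omega f -> omega (phi f).
Proof.
move=> tphi [[psi [h [tpsi hd ->]]]|[delta [b [d0 bz ->]]]].
  by left; exists (phi \o psi), h; split=> //; apply: is_tri_comp.
case: tphi => a [d [p [b' t]]]; right; exists (delta * d), (delta *: b' + b); split.
- by rewrite mulf_neq0 // (tri_delta t).
- exact: in_zD (in_zZ (tri_z t)) bz.
- by rewrite linearD linearZ /= (tri_y t) (fix_in_z (tri_fix_z t) bz) scalerDr scalerA addrA.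
Qed.

(* The Bruhat decomposition, with psi2 fixing y so that it preserves
   nonlinearity under composition. *)
Lemma affine_decomp phi a11 a21 a12 a22 (c1 c2 : A) :
  phi (var lx) = a11 *: var lx + a21 *: var ly + c1 ->
  phi (var ly) = a12 *: var lx + a22 *: var ly + c2 ->
  phi (var lz) = var lz -> in_z c1 -> in_z c2 ->
  a12 != 0 -> a11 * a22 - a21 * a12 != 0 ->
  exists psi1 psi2 lam mu (q : A), [/\ phi =1 psi1 \o (swap_xy \o psi2), is_tri psi1,
    triangular psi2 lam 1 (mu *: var ly + q) 0 & in_z q].
Proof.
(* The constants solve lam y + mu (a12 x + a22 y + c2) + q = a11 x + a21 y + c1, the condition on
   the image of x. Then lam is minus the determinant divided by a12. *)
move=> ex ey ez c1z c2z a0 d0; pose mu := a11 / a12; pose lam := a21 - mu * a22.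
have [q qE qz] : exists2 q : A, q = c1 - mu *: c2 & in_z q.
  by exists (c1 - mu *: c2) => //; rewrite -scaleNr; exact: in_zD c1z (in_zZ c2z).
have lam0 : lam != 0.
  have -> : lam = - (a11 * a22 - a21 * a12) / a12 by rewrite /lam /mu; field.
  by rewrite mulf_neq0 ?oppr_eq0 ?invr_eq0.
have t1 : triangular (tri_sub a12 1 (a22 *: var ly + c2) 0) a12 1 (a22 *: var ly + c2) 0.
  apply: tri_subP => //; [exact: oner_neq0 | | exact: in_z0].
  exact: in_yzD (in_yzZ (@in_yz_var_y _ _)) (in_z_yz c2z).
have t2 : triangular (tri_sub lam 1 (mu *: var ly + q) 0) lam 1 (mu *: var ly + q) 0.
  apply: tri_subP => //; [exact: oner_neq0 | | exact: in_z0].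
  exact: in_yzD (in_yzZ (@in_yz_var_y _ _)) (in_z_yz qz).
move: (tri_sub a12 _ _ _) t1 (tri_sub lam _ _ _) t2 => psi1 t1 psi2 t2.
exists psi1, psi2, lam, mu, q; split=> //; last by do 4 eexists; apply: t1.
have fixq psi : psi (var lz) = var lz -> psi q = q by move=> e; apply: fix_in_z.
apply: (@lrmorph_ext _ _ phi (psi1 \o (swap_xy \o psi2))) => l /=; case: (letterP l) => ->.
- rewrite (tri_x t2) !linearD !linearZ /= !swap_xy_var /= (tri_x t1) (tri_y t1).
  rewrite (fixq swap_xy) ?swap_xy_var // (fixq psi1) ?(tri_fix_z t1) // ex.
  by apply: cfP => s; rewrite qE !(cfD, cfZ, cfN) cf0 /lam /mu; field.
- by rewrite (tri_y t2) addr0 scale1r swap_xy_var (tri_x t1) addrA.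
- by rewrite (tri_fix_z t2) swap_xy_var (tri_fix_z t1).
Qed.

Lemma is_tri_id : is_tri (idfun : {lrmorphism A -> A}).
Proof.
exists 1, 1, 0, 0; split; rewrite ?oner_neq0 //= ?scale1r ?addr0 //; last exact: in_z0.
exact: in_z_yz (@in_z0 _ _).
Qed.

Lemma linear_in_y_dec p : linear_in_y p \/ ~ linear_in_y p.
Proof.
case: (boolP (all (fun s => (ny s == 0%N) || (s == [:: ly])) (wa_supp p))) =>
  [/allP h|/allPn[s ps h]].
  left=> s; rewrite -mem_supp => /h /orP[]/eqP; by [left | right].
by right=> lp; move: ps h; rewrite mem_supp => /lp[] ->.
Qed.

(** If p is not linear in y, the swap just adds a layer to the normal form. Otherwise, when h is
    itself a swap of T2 h2, the map S T S is linear in x and y up to K[z]; it is triangular, or its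
    Bruhat decomposition leaves a single swap. *)
Lemma omega_swap f : omega f -> omega (swap_xy f).
Proof.
case=> [[phi [h [[alpha [delta [p [b t]]]] hd ->]]]|[delta [b [d0 bz ->]]]]; last first.
  left; exists (tri_sub delta 1 b 0), (var lx); split; [|exact: xdominant_x|].
    by do 4 eexists; apply: tri_subP; rewrite ?oner_neq0 //; [apply: in_z_yz | apply: in_z0].
  rewrite linearD linearZ /= swap_xy_var (fix_in_z _ bz) ?swap_xy_var //.
  by rewrite /tri_sub /= sub_var.
have [lp|nl] := linear_in_y_dec p; last first.
  left; exists idfun, (swap_xy (phi h)); split;
    [exact: is_tri_id | exact: xdominant_swap t nl hd | by []].
have [beta [q [qz ep]]] := linear_in_yP (tri_yz t) lp.
have [a0 d0 bz] := And3 (tri_alpha t) (tri_delta t) (tri_z t).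
case: hd => [|phi2 alpha2 delta2 p2 b2 h2 t2 nl2 hd2].
  rewrite (tri_x t) ep !linearD !linearZ /= !swap_xy_var (fix_in_z _ qz) ?swap_xy_var //=.
  (* For beta = 0 the result is alpha y + q, in the family kept outside the normal form. *)
  case: (eqVneq beta 0) => [->|b0].
    by right; exists alpha, q; rewrite scale0r add0r.
  left; exists (tri_sub beta 1 (alpha *: var ly + q) 0), (var lx); split; last 1 first.
  - by rewrite /tri_sub /= sub_var /= addrCA.
  - do 4 eexists; apply: tri_subP; rewrite ?oner_neq0 //; last exact: in_z0.
    exact: in_yzD (in_yzZ (@in_yz_var_y _ _)) (in_z_yz qz).
  - exact: xdominant_x.
have [psi psiE] : exists psi : {lrmorphism A -> A}, psi =1 swap_xy \o (phi \o swap_xy).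
  by exists (swap_xy \o (phi \o swap_xy)).
have -> : swap_xy (phi (swap_xy (phi2 h2))) = psi (phi2 h2) by rewrite psiE.
have px : psi (var lx) = delta *: var lx + 0 *: var ly + b.
  rewrite psiE /= swap_xy_var (tri_y t) linearD linearZ /= swap_xy_var (fix_in_z _ bz)
    ?swap_xy_var //.
  by rewrite scale0r addr0.
have py : psi (var ly) = beta *: var lx + alpha *: var ly + q.
  rewrite psiE /= swap_xy_var (tri_x t) ep !linearD !linearZ /= !swap_xy_var (fix_in_z _ qz)
    ?swap_xy_var //.
  by rewrite addrA [alpha *: _ + _]addrC.
have pz : psi (var lz) = var lz by rewrite psiE /= swap_xy_var (tri_fix_z t) swap_xy_var.
case: (eqVneq beta 0) => [b0|b0].
  left; exists (psi \o phi2), h2; split=> //.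
  have tp : triangular psi delta alpha b q.
    split=> //; first exact: in_z_yz.
      by rewrite px scale0r addr0.
    by rewrite py b0 scale0r add0r.
  by do 4 eexists; apply: tri_comp tp t2.
have [|psi1 [psi2 [lam [mu [r [e t1 t3 rz]]]]]] := affine_decomp px py pz bz qz b0.
  by rewrite mul0r subr0 mulf_neq0.
rewrite e /=; apply: omega_tri t1 _; left; exists idfun, (swap_xy (psi2 (phi2 h2))); split=>
  //; first exact: is_tri_id.
(* As [psi2] fixes y, it fixes p2, so the polynomial of the composite is p2 plus an element of K y +
   K[z]: it is still not linear in y. *)
have t4 := tri_comp t3 t2; apply: (xdominant_swap t4) => // lin4; apply: nl2 => s ps.
have e2 : psi2 p2 = p2.
  apply: (@lrmorph_ext_yz _ _ psi2 idfun) (tri_yz t2) => /=; last exact: tri_fix_z t3.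
  by rewrite (tri_y t3) addr0 scale1r.
case: (posnP (ny s)) => ys; first by left.
case: (s =P [:: ly]) => es; first by right.
case: (lin4 s) => [|//|//]; last by move=> e0; rewrite e0 in ys.
rewrite e2 cfD cfZ cfD cfZ cf_var; case: (s =P _) => // _.
case: (eqVneq (cf r s) 0) => [->|/rz[_ e0]]; last by rewrite e0 in ys.
by rewrite mulr0 addr0 mulr0 add0r.
Qed.

Lemma omega_triE phi f : is_tri phi -> omega (phi f) <-> omega f.
Proof.
move=> t; split; last exact: omega_tri.
by have [psi [t' K1 _]] := tri_inv t; move/(omega_tri t'); rewrite K1.
Qed.

Lemma omega_swapE f : omega (swap_xy f) <-> omega f.
Proof. by split=> [/omega_swap|/omega_swap//]; rewrite swap_xyK. Qed.

Lemma omega_affine phi a11 a21 a12 a22 (c1 c2 : A) f :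
  phi (var lx) = a11 *: var lx + a21 *: var ly + c1 ->
  phi (var ly) = a12 *: var lx + a22 *: var ly + c2 ->
  phi (var lz) = var lz -> in_z c1 -> in_z c2 -> a11 * a22 - a21 * a12 != 0 ->
  omega (phi f) <-> omega f.
Proof.
move=> ex ey ez c1z c2z d0; case: (eqVneq a12 0) => [a0|a0].
  have := d0; rewrite a0 mulr0 subr0 mulf_eq0 negb_or => /andP[a110 a220].
  apply: omega_triE; exists a11, a22, (a21 *: var ly + c1), c2; split=> //.
  - exact: in_yzD (in_yzZ (@in_yz_var_y _ _)) (in_z_yz c1z).
  - by rewrite ex addrA.
  - by rewrite ey a0 scale0r add0r.
have [psi1 [psi2 [lam [mu [q [e t1 t2 _]]]]]] := affine_decomp ex ey ez c1z c2z a0 d0.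
rewrite e /= (omega_triE _ t1) omega_swapE; apply: omega_triE.
by do 4 eexists; apply: t2.
Qed.

Lemma terminal_tri f : terminal f -> exists2 phi, is_tri phi &
  f = phi (var lx) \/ f = swap_xy (phi (var lx)).
Proof.
case=> al [be [b [ab bz ->]]]; case: (eqVneq al 0) ab => [->|a0] /= ab.
  have t : triangular (tri_sub be 1 b 0) be 1 b 0.
    by apply: tri_subP; rewrite ?oner_neq0 //; [apply: in_z_yz | apply: in_z0].
  exists (tri_sub be 1 b 0); first by do 4 eexists; apply: t.
  right; rewrite (tri_x t) linearD linearZ /= swap_xy_var (fix_in_z _ bz) ?swap_xy_var //.
  by rewrite scale0r add0r.
have t : triangular (tri_sub al 1 (be *: var ly + b) 0) al 1 (be *: var ly + b) 0.
  apply: tri_subP; rewrite ?oner_neq0 //; last exact: in_z0.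
  exact: in_yzD (in_yzZ (@in_yz_var_y _ _)) (in_z_yz bz).
exists (tri_sub al 1 (be *: var ly + b) 0); first by do 4 eexists; apply: t.
by left; rewrite (tri_x t) addrA.
Qed.

Lemma omega_x : omega (var lx).
Proof.
left; exists idfun, (var lx); split=> //; [exact: is_tri_id | exact: xdominant_x].
Qed.

End Orbit.

(** * The orbit of x and z-tame coordinates *)

Section Coordinates.
Variable K : fieldType.
Local Notation A := (free_word_algebra K).
Implicit Types (f g p b : free_alg K).
Implicit Types phi psi : {lrmorphism free_alg K -> free_alg K}.

Lemma var_xyz : (var A lx = Xx) * (var A ly = Xy) * (var A lz = Xz).
Proof. by rewrite /var /= /free_mon /Xx /Xy /Xz !fmuE. Qed.

Lemma in_yz_letters p : in_yz (A := A) p <-> only_letters [:: ly; lz] p.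
Proof.
split=> [pP [s] sp l ls|pP s sp].
  rewrite -mcoeff_neq0 in sp; move: (pP s sp) ls => /= xs ls.
  by case: (letterP l) ls => ->; rewrite ?inE // nx_mem xs.
have := pP (FMonom s); rewrite -mcoeff_neq0 => /(_ sp) /= h.
by apply/eqP; rewrite -[_ == _]negbK -lt0n -nx_mem; apply/negP => /h.
Qed.

Lemma in_z_letters p : in_z (A := A) p <-> only_letters [:: lz] p.
Proof.
split=> [pP [s] sp l ls|pP s sp].
  rewrite -mcoeff_neq0 in sp; move: (pP s sp) ls => /= [xs ys] ls.
  by case: (letterP l) ls => ->; rewrite ?inE // ?nx_mem ?xs // ny_mem ys.
have := pP (FMonom s); rewrite -mcoeff_neq0 => /(_ sp) /= h.
by split; apply/eqP; rewrite -[_ == _]negbK -lt0n -?nx_mem -?ny_mem; apply/negP => /h.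
Qed.

Lemma tame_tri (phi : {lrmorphism A -> A}) : is_tri phi -> z_tame phi.
Proof.
move=> t; have [psi [_ K1 K2]] := tri_inv t; case: t => al [d [p [b t]]].
apply: (@z_tame_triangular K phi); split.
  by split; [exists psi | have := tri_fix_z t; rewrite var_xyz].
exists al, d, p, b; split.
- by split; [apply: tri_alpha t | apply: tri_delta t].
- exact/in_yz_letters/(tri_yz t).
- exact/in_z_letters/(tri_z t).
- by have := tri_x t; rewrite var_xyz.
- by have := tri_y t; rewrite var_xyz.
Qed.

Lemma det_mx22 (M : 'M[K]_2) : \det M = M 0 0 * M 1 1 - M 0 1 * M 1 0.
Proof.
rewrite (expand_det_row _ 0) !big_ord_recl big_ord0 /cofactor !det_mx11 !mxE /= addr0.
rewrite expr0 expr1 mul1r mulN1r mulrN.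
by congr (M _ _ * M _ _ - M _ _ * M _ _); exact/val_inj.
Qed.

Lemma swap_xy_xy : (swap_xy A Xx = Xy) * (swap_xy A Xy = Xx).
Proof.
by split; rewrite -!var_xyz swap_xy_var.
Qed.

Lemma tame_swap_xy : z_tame (swap_xy A).
Proof.
apply: (@z_tame_affine K (swap_xy A)); split.
  split; first by exists (swap_xy A); apply: swap_xyK.
  by have := swap_xy_var A lz; rewrite var_xyz.
exists (\matrix_(i, j) (i != j)%:R), 0, 0, 0, 0; split.
- by rewrite unitmxE det_mx22 !mxE /= mulr0 mulr1 sub0r unitrN unitr1.
- by rewrite swap_xy_xy !mxE /= !scale0r scale1r add0r !addr0.
- by rewrite swap_xy_xy !mxE /= !scale0r scale1r !addr0.
Qed.

(** An equivalence, so that the induction passes through inverses of tame maps. *)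
Lemma omega_tame (phi : free_alg K -> free_alg K) : z_tame phi -> forall f,
  omega (A := A) (phi f) <-> omega (A := A) f.
Proof.
have z_var : in_z (var A lz).
  by move=> s; rewrite cf_var; case: (s =P _) => [->|] //; rewrite eqxx.
have z_cst c : in_z (c *: 1 : A).
  rewrite -mon1; apply: in_zZ => s; rewrite cf_mon.
  by case: ([::] =P s) => [<-|] //; rewrite eqxx.
elim=> {phi} [phi hphi|phi hphi||phi psi _ IH1 _ IH2|phi psi _ IH K1 K2] f //.
- case: hphi => [[_ ez] [al [a31 [a32 [b1 [b2 [ua ex ey]]]]]]].
  apply: (@omega_affine K A phi (al 0 0) (al 1 0) (al 0 1) (al 1 1)
    (a31 *: var A lz + b1 *: 1) (a32 *: var A lz + b2 *: 1)).
  + by rewrite addrA !var_xyz; exact: ex.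
  + by rewrite addrA !var_xyz; exact: ey.
  + by rewrite !var_xyz; exact: ez.
  + exact: in_zD (in_zZ z_var) (z_cst b1).
  + exact: in_zD (in_zZ z_var) (z_cst b2).
  + by rewrite [al 1 0 * _]mulrC -det_mx22 -unitfE -unitmxE.
- case: hphi => [[_ ez] [a1 [a2 [p1 [p2 [[a10 a20] p1P p2P ex ey]]]]]].
  apply: (@omega_triE K A phi); exists a1, a2, p1, p2; split.
  + exact: a10.
  + exact: a20.
  + exact/in_yz_letters.
  + exact/in_z_letters.
  + by rewrite !var_xyz; exact: ex.
  + by rewrite !var_xyz; exact: ey.
  + by rewrite !var_xyz; exact: ez.
- by rewrite /= IH1 IH2.
- by rewrite -IH K2.
Qed.

Lemma coordinate_omega f : z_tame_coordinate f -> omega (A := A) f.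
Proof.
case=> phi tphi ->; apply/(omega_tame tphi).
by have := omega_x A; rewrite var_xyz.
Qed.

(** This makes every step of the search safe, including those that come from no factorization of
    f. *)
Lemma coordinate_tame (phi psi : free_alg K -> free_alg K) f : z_tame phi -> z_tame psi ->
  cancel phi psi ->
  z_tame_coordinate (phi f) <-> z_tame_coordinate f.
Proof.
move=> t1 t2 K1; split=> [[chi t e]|[chi t ->]]; last by exists (phi \o chi) => //;
  apply: z_tame_comp.
by exists (psi \o chi); [apply: z_tame_comp | rewrite /= -e K1].
Qed.

Lemma terminal_coordinate f : terminal (A := A) f -> z_tame_coordinate f.
Proof.
case/terminal_tri => phi /tame_tri t; rewrite var_xyz => -[->|->].
  by exists phi.
by exists (swap_xy A \o phi) => //; apply: z_tame_comp tame_swap_xy t.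
Qed.

End Coordinates.

(** * Computable functions between coded types *)

(** A relation, because an element may have many codes and not every tree is a code; a program is
    specified on codes only. *)
Class coded (A : Type) := code : tree -> A -> Prop.

Definition computable A B {cA : coded A} {cB : coded B} (f : A -> B) : Prop :=
  exists p, forall t a, code t a -> exists2 u, run p t u & code u (f a).

#[global] Instance coded_bool : coded bool := fun t b => t = tree_of_bool b.
#[global] Instance coded_unit : coded unit := fun _ _ => True.
#[global] Instance coded_letter : coded 'I_3 := fun t l => letter_of_tree t = Some l.

#[global] Instance coded_prod A B (cA : coded A) (cB : coded B) : coded (A * B) :=
  fun t q => if t is Node t1 t2 then code t1 q.1 /\ code t2 q.2 else False.

Fixpoint code_seq A (cA : coded A) (t : tree) (s : seq A) : Prop :=
  match t, s with
  | Leaf, [::] => True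
  | Node h t', a :: s' => code h a /\ code_seq cA t' s'
  | _, _ => False
  end.
#[global] Instance coded_seq A (cA : coded A) : coded (seq A) := code_seq cA.

(** Unary numbers. As every tree codes [tt], a list of any trees codes its own length, and
    arithmetic reduces to programs on lists. *)
#[global] Instance coded_nat : coded nat := fun t n => code t (nseq n tt).

Section Combinators.
Context {G A B C : Type} {cG : coded G} {cA : coded A} {cB : coded B} {cC : coded C}.

Lemma comp_id : computable (fun x : A => x).
Proof. by exists PId => t a h; exists t => //; constructor. Qed.

Lemma comp_comp (g : B -> C) (f : G -> B) :
  computable g -> computable f -> computable (fun x => g (f x)).
Proof.
move=> [p hp] [q hq]; exists (PComp p q) => t a /hq[u r1 /hp[w r2 hw]].
by exists w => //; apply: run_comp r1 r2.
Qed.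

Lemma comp_pair (f : G -> A) (g : G -> B) :
  computable f -> computable g -> computable (fun x => (f x, g x)).
Proof.
move=> [p hp] [q hq]; exists (PPair p q) => t a ta.
have [u r1 h1] := hp _ _ ta; have [w r2 h2] := hq _ _ ta.
by exists (Node u w); [apply: run_pair | split].
Qed.

Lemma comp_fst (f : G -> A * B) : computable f -> computable (fun x => (f x).1).
Proof.
move=> [p hp]; exists (PComp PFst p) => t a /hp[[|u w] r //= [h1 h2]].
by exists u => //; apply: run_comp r _; constructor.
Qed.

Lemma comp_snd (f : G -> A * B) : computable f -> computable (fun x => (f x).2).
Proof.
move=> [p hp]; exists (PComp PSnd p) => t a /hp[[|u w] r //= [h1 h2]].
by exists w => //; apply: run_comp r _; constructor.
Qed.

Lemma comp_cst (a : A) : (exists t, code t a) -> computable (fun _ : G => a).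
Proof.
case=> t ta; suff [p hp] : exists p, forall s, run p s t.
  by exists p => s x _; exists t.
elim: t {ta} => [|t1 [p1 h1] t2 [p2 h2]].
  by exists PLeaf => s; constructor.
by exists (PPair p1 p2) => s; constructor.
Qed.

Lemma comp_if (b : G -> bool) (f g : G -> A) :
  computable b -> computable f -> computable g ->
  computable (fun x => if b x then f x else g x).
Proof.
move=> [c hc] [p hp] [q hq]; exists (PIf c p q) => t a ta.
have [u rc eu] := hc _ _ ta; have [v rp hv] := hp _ _ ta; have [w rq hw] := hq _ _ ta.
rewrite eu {u eu} in rc; case: (b a) rc => rc; [exists v => // | exists w => //].
  exact: run_if_true rc rp.
exact: run_if_false rc rq.
Qed.

Lemma comp_cons (f : G -> A) (s : G -> seq A) :
  computable f -> computable s -> computable (fun x => f x :: s x).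
Proof.
move=> [p hp] [q hq]; exists (PPair p q) => t a ta.
have [u r1 h1] := hp _ _ ta; have [w r2 h2] := hq _ _ ta.
by exists (Node u w); [apply: run_pair | split].
Qed.

(** The recursion on lists below is reduced to this loop. The state consists of the input, the
    remaining list and the accumulator; since the empty list is [Leaf], the remaining list itself is
    the loop condition. *)
Lemma comp_foldl (F : G -> B -> A -> B) (b : G -> B) (s : G -> seq A) :
  computable (fun q : G * B * A => F q.1.1 q.1.2 q.2) ->
  computable b -> computable s -> computable (fun x => foldl (F x) (b x) (s x)).
Proof.
move=> [pF hF] [pb hb] [ps hs].
pose lst := PComp PFst PSnd; pose acc := PComp PSnd PSnd.
pose body := PPair PFst (PPair (PComp PSnd lst)
  (PComp pF (PPair (PPair PFst acc) (PComp PFst lst)))).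
exists (PComp acc (PComp (PWhile lst body) (PPair PId (PPair ps pb)))) => t x tx.
have [ts rs hts] := hs _ _ tx; have [tb rb htb] := hb _ _ tx.
have run_lst t1 t2 t3 : run lst (Node t1 (Node t2 t3)) t2.
  by apply: run_comp (run_snd _ _) (run_fst _ _).
have run_acc t1 t2 t3 : run acc (Node t1 (Node t2 t3)) t3.
  by apply: run_comp (run_snd _ _) (run_snd _ _).
suff [ta ra hta] : exists2 ta, run (PWhile lst body) (Node t (Node ts tb)) (Node t (Node Leaf ta))
    & @code B cB ta (foldl (F x) (b x) (s x)).
  exists ta => //; apply: run_comp (run_acc t Leaf ta).
  by apply: run_comp ra; apply: run_pair (run_id _) (run_pair rs rb).
have {}hts : code_seq cA ts (s x) := hts.
move: (b x) (s x) ts tb {rs rb} hts htb => b0 s0.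
elim: s0 b0 => [|a s0 IH] b0 [|ta ts] tb //=.
  move=> _ hb0; exists tb => //; exact: run_while_stop (run_lst _ _ _).
move=> [ha hts] hb0.
have [tb' rF hb'] := hF (Node (Node t tb) ta) (x, b0, a) (conj (conj tx hb0) ha).
have [tr rr htr] := IH _ ts tb' hts hb'; exists tr => //.
apply: run_while_step rr; first exact: run_lst.
apply: run_pair (run_fst _ _) (run_pair _ _).
  exact: run_comp (run_lst _ _ _) (run_snd _ _).
apply: run_comp rF; apply: run_pair (run_pair (run_fst _ _) (run_acc _ _ _)) _.
exact: run_comp (run_lst _ _ _) (run_fst _ _).
Qed.

End Combinators.

Section MoreCombinators.
Context {G A B C D : Type} {cG : coded G} {cA : coded A} {cB : coded B} {cC : coded C}
  {cD : coded D}.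

Lemma comp_ext (f g : G -> A) : f =1 g -> computable f -> computable g.
Proof. by move=> e [p hp]; exists p => t a; rewrite -e; apply: hp. Qed.

Lemma comp_app2 (f : A -> B -> C) (a : G -> A) (b : G -> B) :
  computable (fun q : A * B => f q.1 q.2) -> computable a -> computable b ->
  computable (fun x => f (a x) (b x)).
Proof. by move=> hf ha hb; apply: (comp_comp hf (comp_pair ha hb)). Qed.

Lemma comp_app3 (f : A -> B -> C -> D) (a : G -> A) (b : G -> B) (c : G -> C) :
  computable (fun q : A * B * C => f q.1.1 q.1.2 q.2) ->
  computable a -> computable b -> computable c ->
  computable (fun x => f (a x) (b x) (c x)).
Proof. by move=> hf ha hb hc; apply: (comp_comp hf (comp_pair (comp_pair ha hb) hc)). Qed.

Lemma comp_nil : computable (fun _ : G => [::] : seq A).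
Proof. by apply: comp_cst; exists Leaf. Qed.

Lemma comp_bool (b : bool) : computable (fun _ : G => b).
Proof. by apply: comp_cst; exists (tree_of_bool b). Qed.

Lemma comp_letter (l : 'I_3) : computable (fun _ : G => l).
Proof.
apply: comp_cst; case: (letterP l) => ->; [by exists Leaf | by exists (Node Leaf Leaf)|].
by exists (Node Leaf (Node Leaf Leaf)).
Qed.

Lemma comp_nat0 : computable (fun _ : G => 0%N).
Proof. by apply: comp_cst; exists Leaf. Qed.

Lemma comp_not (b : G -> bool) : computable b -> computable (fun x => ~~ b x).
Proof. move=> hb; exact: comp_if hb (comp_bool false) (comp_bool true). Qed.

Lemma comp_and (a b : G -> bool) :
  computable a -> computable b -> computable (fun x => a x && b x).
Proof. move=> ha hb; exact: comp_if ha hb (comp_bool false). Qed.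

Lemma comp_or (a b : G -> bool) :
  computable a -> computable b -> computable (fun x => a x || b x).
Proof. move=> ha hb; exact: comp_if ha (comp_bool true) hb. Qed.

End MoreCombinators.

Ltac comp_proj := lazymatch goal with
  | |- computable (fun x => x) => exact: comp_id
  | |- computable fst => exact: (comp_fst comp_id)
  | |- computable snd => exact: (comp_snd comp_id)
  | |- computable (fun x => fst (@?f x)) => apply: comp_fst; comp_proj
  | |- computable (fun x => snd (@?f x)) => apply: comp_snd; comp_proj
  | |- computable (fun x => (@?f x) :: (@?g x)) => apply: comp_cons; comp_proj
  | _ => idtac
  end.

(** * Programs on lists *)

Section Sequences.
Context {G A B : Type} {cG : coded G} {cA : coded A} {cB : coded B}.

Lemma comp_rev (s : G -> seq A) : computable s -> computable (fun x => rev (s x)).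
Proof.
move=> hs; apply: (comp_ext (f := fun x => foldl (fun b a => a :: b) [::] (s x))).
  by move=> x; rewrite -[s x]revK foldl_rev revK; elim: (rev _) => //= a r ->.
by apply: comp_foldl comp_nil hs; comp_proj.
Qed.

Lemma comp_foldr (F : G -> A -> B -> B) (b : G -> B) (s : G -> seq A) :
  computable (fun q : G * A * B => F q.1.1 q.1.2 q.2) ->
  computable b -> computable s -> computable (fun x => foldr (F x) (b x) (s x)).
Proof.
move=> hF hb hs.
apply: (comp_ext (f := fun x => foldl (fun b a => F x a b) (b x) (rev (s x)))).
  by move=> x; rewrite foldl_rev.
apply: comp_foldl hb (comp_rev hs).
by apply: (comp_app3 (f := F)) => //; comp_proj.
Qed.

End Sequences.

Section MoreSequences.
Context {G A B : Type} {cG : coded G} {cA : coded A} {cB : coded B}.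

Lemma comp_map (F : G -> A -> B) (s : G -> seq A) :
  computable (fun q : G * A => F q.1 q.2) -> computable s ->
  computable (fun x => map (F x) (s x)).
Proof.
move=> hF hs; apply: (comp_ext (f := fun x => foldr (fun a b => F x a :: b) [::] (s x))).
  by move=> x; elim: (s x) => //= a r ->.
apply: comp_foldr comp_nil hs; apply: comp_cons; last by comp_proj.
by apply: (comp_app2 hF); comp_proj.
Qed.

Lemma comp_filter (P : G -> A -> bool) (s : G -> seq A) :
  computable (fun q : G * A => P q.1 q.2) -> computable s ->
  computable (fun x => filter (P x) (s x)).
Proof.
move=> hP hs.
apply: (comp_ext (f := fun x => foldr (fun a b => if P x a then a :: b else b) [::] (s x))).
  by move=> x; elim: (s x) => //= a r ->.
apply: comp_foldr comp_nil hs; apply: comp_if; [|by comp_proj ..].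
by apply: (comp_app2 hP); comp_proj.
Qed.

Lemma comp_has (P : G -> A -> bool) (s : G -> seq A) :
  computable (fun q : G * A => P q.1 q.2) -> computable s ->
  computable (fun x => has (P x) (s x)).
Proof.
move=> hP hs; apply: (comp_ext (f := fun x => foldr (fun a b => P x a || b) false (s x))).
  by move=> x; elim: (s x) => //= a r ->.
apply: comp_foldr (comp_bool _) hs; apply: comp_or; last by comp_proj.
by apply: (comp_app2 hP); comp_proj.
Qed.

Lemma comp_all (P : G -> A -> bool) (s : G -> seq A) :
  computable (fun q : G * A => P q.1 q.2) -> computable s ->
  computable (fun x => all (P x) (s x)).
Proof.
move=> hP hs; apply: (comp_ext (f := fun x => foldr (fun a b => P x a && b) true (s x))).
  by move=> x; elim: (s x) => //= a r ->.
apply: comp_foldr (comp_bool _) hs; apply: comp_and; last by comp_proj.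
by apply: (comp_app2 hP); comp_proj.
Qed.

Lemma comp_cat (s t : G -> seq A) :
  computable s -> computable t -> computable (fun x => s x ++ t x).
Proof.
move=> hs ht; apply: (comp_ext (f := fun x => foldr (fun a b => a :: b) (t x) (s x))).
  by move=> x; elim: (s x) => //= a r ->.
by apply: comp_foldr ht hs; comp_proj.
Qed.

Lemma comp_head (a : G -> A) (s : G -> seq A) : computable a -> computable s ->
  computable (fun x => head (a x) (s x)).
Proof.
move=> ha hs; apply: (comp_ext (f := fun x => foldr (fun a _ => a) (a x) (s x))).
  by move=> x; case: (s x).
by apply: comp_foldr ha hs; comp_proj.
Qed.

Lemma comp_nilp (s : G -> seq A) : computable s -> computable (fun x => nilp (s x)).
Proof.
move=> hs; apply: (comp_ext (f := fun x => foldr (fun _ _ => false) true (s x))).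
  by move=> x; case: (s x).
by apply: comp_foldr (comp_bool _) hs; apply: comp_bool.
Qed.

Lemma comp_behead (s : G -> seq A) : computable s -> computable (fun x => behead (s x)).
Proof.
case=> p hp; exists (PComp PSnd p) => t x /hp[u r hu].
move: hu r; case: (s x) => [|a r]; case: u => [|h t'] //=.
  by exists Leaf => //; apply: run_comp r (run_snd_leaf).
by case=> _ ht' r'; exists t' => //; apply: run_comp r' (run_snd _ _).
Qed.

End MoreSequences.

Lemma comp_flatten G A (cG : coded G) (cA : coded A) (s : G -> seq (seq A)) :
  computable s -> computable (fun x => flatten (s x)).
Proof.
by move=> hs; apply: comp_foldr comp_nil hs; apply: comp_cat; comp_proj.
Qed.

(** * Programs on unary numbers and letters *)

Section Naturals.
Context {G B : Type} {cG : coded G} {cB : coded B}.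
Implicit Types m n : G -> nat.

Lemma comp_nseq n : computable n -> computable (fun x => nseq (n x) tt).
Proof. by []. Qed.

Lemma comp_size_tt (s : G -> seq unit) : computable s -> computable (fun x => size (s x)).
Proof.
case=> p hp; exists p => t x /hp[u r hu]; exists u => //.
suff e : nseq (size (s x)) tt = s x by rewrite /code /coded_nat e.
by elim: (s x) => //= -[] r' ->.
Qed.

Lemma comp_S n : computable n -> computable (fun x => (n x).+1).
Proof.
move=> /comp_nseq hn; apply: (comp_ext (f := fun x => size (tt :: nseq (n x) tt))).
  by move=> x /=; rewrite size_nseq.
by apply: comp_size_tt; apply: comp_cons hn; apply: comp_cst; exists Leaf.
Qed.

Lemma comp_P n : computable n -> computable (fun x => (n x).-1).
Proof.
move=> /comp_nseq hn; apply: (comp_ext (f := fun x => size (behead (nseq (n x) tt)))).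
  by move=> x; rewrite size_behead size_nseq.
exact: comp_size_tt (comp_behead hn).
Qed.

Lemma comp_iter (F : G -> B -> B) n (b : G -> B) :
  computable (fun q : G * B => F q.1 q.2) -> computable n -> computable b ->
  computable (fun x => iter (n x) (F x) (b x)).
Proof.
move=> hF /comp_nseq hn hb.
apply: (comp_ext (f := fun x => foldr (fun _ c => F x c) (b x) (nseq (n x) tt))).
  by move=> x; elim: (n x) => //= k ->.
by apply: comp_foldr hb hn; apply: (comp_app2 hF); comp_proj.
Qed.

End Naturals.

Section Arithmetic.
Context {G : Type} {cG : coded G}.
Implicit Types m n : G -> nat.

Lemma comp_addn m n : computable m -> computable n -> computable (fun x => m x + n x)%N.
Proof.
move=> hm hn; apply: (comp_ext (f := fun x => iter (m x) S (n x))).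
  by move=> x; elim: (m x) => //= k ->.
by apply: comp_iter hm hn; apply: comp_S; comp_proj.
Qed.

Lemma comp_subn m n : computable m -> computable n -> computable (fun x => m x - n x)%N.
Proof.
move=> hm hn; apply: (comp_ext (f := fun x => iter (n x) predn (m x))).
  by move=> x; elim: (n x) => [|k /= ->]; rewrite ?subn0 ?subnS.
by apply: comp_iter hn hm; apply: comp_P; comp_proj.
Qed.

Lemma comp_leq m n : computable m -> computable n -> computable (fun x => m x <= n x)%N.
Proof.
move=> hm hn; apply: (comp_ext (f := fun x => nilp (nseq (m x - n x) tt))).
  by move=> x; rewrite /nilp size_nseq.
exact: comp_nilp (comp_nseq (comp_subn hm hn)).
Qed.

Lemma comp_eqn m n : computable m -> computable n -> computable (fun x => m x == n x)%N.
Proof.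
move=> hm hn; apply: (comp_ext (f := fun x => (m x <= n x) && (n x <= m x)))%N.
  by move=> x; rewrite eqn_leq.
by apply: comp_and; apply: comp_leq.
Qed.

Lemma letter_codeP u (l : 'I_3) : code u l -> u =
  if l == lx then Leaf else if l == ly then Node Leaf Leaf else Node Leaf (Node Leaf Leaf).
Proof. by rewrite /code /coded_letter; case: u => [|[|? ?] [|[|? ?] [|? ?]]] //= [<-]. Qed.

(** The letter x is coded by [Leaf], the false value, so the code of the letter is the condition and
    the answers are exchanged. *)
Lemma comp_is_x (l : G -> 'I_3) : computable l -> computable (fun x => l x == lx).
Proof.
case=> p hp; exists (PIf p PLeaf (PPair PLeaf PLeaf)) => t x /hp[u r /letter_codeP hu].
exists (tree_of_bool (l x == lx)) => //; move: hu; case: (letterP (l x)) => -> /= hu.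
- by rewrite hu in r; apply: run_if_false r (run_pair (run_leaf _) (run_leaf _)).
- by rewrite hu in r; apply: run_if_true r (run_leaf _).
- by rewrite hu in r; apply: run_if_true r (run_leaf _).
Qed.

(** The codes of y and z differ in the second component, which is [Leaf] for y only. *)
Lemma comp_is_y (l : G -> 'I_3) : computable l -> computable (fun x => l x == ly).
Proof.
case=> p hp.
exists (PIf p (PIf (PComp PSnd p) PLeaf (PPair PLeaf PLeaf)) PLeaf) =>
  t x /hp[u r /letter_codeP hu].
exists (tree_of_bool (l x == ly)) => //; move: hu; case: (letterP (l x)) => -> /= hu.
- by rewrite hu in r; apply: run_if_false r (run_leaf _).
- rewrite hu in r.
  exact: (run_if_true _ r (run_if_false _ (run_comp r (run_snd _ _))
    (run_pair (run_leaf _) (run_leaf _)))).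
- rewrite hu in r.
  exact: (run_if_true _ r (run_if_true _ (run_comp r (run_snd _ _)) (run_leaf _))).
Qed.

End Arithmetic.

(** A terminating run of the loop, as a relation: termination rests on a well-founded order and is
    supplied separately by [iterates_nexts]. *)
Inductive iterates A (c : A -> bool) (b : A -> A) : A -> A -> Prop :=
| iterates_stop a : ~~ c a -> iterates c b a a
| iterates_step a h : c a -> iterates c b (b a) h -> iterates c b a h.

Lemma comp_while A (cA : coded A) (c : A -> bool) (b : A -> A) :
  computable c -> computable b ->
  exists p, forall t a h, code t a -> iterates c b a h -> exists2 u, run p t u & code u h.
Proof.
move=> [pc hc] [pb hb]; exists (PWhile pc pb) => t a h ta it; elim: it t ta => {a h} [a|a h].
  move=> /negbTE ca t ta; exists t => //; apply: run_while_stop.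
  by have [u r eu] := hc _ _ ta; rewrite ca in eu; rewrite eu in r.
move=> ca _ IH t ta; have [u r eu] := hc _ _ ta; have [v rb hv] := hb _ _ ta.
have [w rw hw] := IH _ hv; exists w => //.
by rewrite ca in eu; rewrite eu in r; apply: run_while_step r rb rw.
Qed.

(** * The decision procedure *)

Section WordAlgorithms.
Implicit Types (u v w : seq 'I_3).

(** The accumulator holds the suffixes of the part already read, and a new letter is appended to
    each. Being a fold, it falls under [comp_foldl]; prefixes are then obtained by reversal. *)
Definition tails u : seq (seq 'I_3) :=
  foldl (fun acc l => [::] :: [seq rcons t l | t <- acc]) [:: [::]] u.

Definition factors u : seq (seq 'I_3) :=
  flatten [seq [seq rev s | s <- tails (rev t)] | t <- tails u].

Lemma mem_tails u v : v \in tails (u ++ v).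
Proof.
elim/last_ind: v => [|v l IH].
  by rewrite cats0; case/lastP: u => [|u l]; rewrite ?inE // /tails foldl_rcons inE eqxx.
rewrite -rcons_cat /tails foldl_rcons inE; apply/orP; right.
exact: map_f IH.
Qed.

Lemma mem_factors u v w : v \in factors (u ++ v ++ w).
Proof.
apply/flatten_mapP; exists (v ++ w); first exact: mem_tails.
by rewrite rev_cat -[X in X \in _]revK; apply: map_f; apply: mem_tails.
Qed.

End WordAlgorithms.

Section Algorithm.
Variable K : fieldType.
Implicit Types (f g : seq (K * seq 'I_3)) (u v w : seq 'I_3) (c : K) (l : 'I_3).

(** Terms are never collected, so a coefficient is a sum over all terms with the word w. *)
Definition pcoef f w : K := foldl (fun s q => if q.2 == w then s + q.1 else s) 0 f.
Definition psupp f : seq (seq 'I_3) := [seq w <- [seq q.2 | q <- f] | pcoef f w != 0].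

Definition pmul f g : seq (K * seq 'I_3) :=
  flatten [seq [seq (q.1 * r.1, q.2 ++ r.2) | r <- g] | q <- f].
Definition pletter v c l : seq (K * seq 'I_3) :=
  if l == lx then [:: (1, [:: lx]); (- c, v)] else [:: (1, [:: l])].
Definition pstep v c f : seq (K * seq 'I_3) :=
  flatten [seq foldr (fun l acc => pmul (pletter v c l) acc) [:: (q.1, [::])] q.2 | q <- f].
Definition pswap f : seq (K * seq 'I_3) := [seq (q.1, swap_word q.2) | q <- f].

Definition candidates f : seq (seq 'I_3 * K) :=
  flatten [seq flatten [seq
    [seq (v, pcoef f u / pcoef f w) | v <- factors u & all (fun l => l != lx) v]
  | u <- psupp f] | w <- psupp f].

Definition pless g f : bool := has (fun u => all (fun u' => wlt u' u) (psupp g)) (psupp f).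

Definition xsteps f : seq (seq (K * seq 'I_3)) := [seq pstep q.1 q.2 f | q <- candidates f].

(** The filter by [pless] makes the process stop for every f, whether or not it is a coordinate. *)
Definition nexts f : seq (seq (K * seq 'I_3)) :=
  [seq g <- xsteps f ++ [seq pswap g | g <- xsteps (pswap f)] | pless g f].

Definition pterminal f : bool :=
  all (fun w => [|| w == [:: lx], w == [:: ly] | all (fun l =>
    ~~ (l == lx) && ~~ (l == ly)) w]) (psupp f)
  && has (fun w => (w == [:: lx]) || (w == [:: ly])) (psupp f).

Section Semantics.
Variable A : word_algebra K.
Local Notation mon := (@wa_mon K A).
Local Notation cf := (@wa_coef K A).

Definition eval f : A := \sum_(q <- f) q.1 *: mon q.2.

Lemma cf_eval f w : cf (eval f) w = pcoef f w.
Proof.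
rewrite /eval cf_sum; elim/last_ind: f => [|f q IH]; first by rewrite big_nil.
rewrite -cats1 big_cat big_seq1 /= IH /pcoef foldl_cat /= -/(pcoef f w) cfZ cf_mon.
by case: eqP => _; rewrite ?mulr1 // mulr0 addr0.
Qed.

Lemma mem_psupp f w : (w \in psupp f) = (cf (eval f) w != 0).
Proof.
rewrite mem_filter -cf_eval andb_idr // /eval cf_sum; apply: contraR => nw.
rewrite big_seq big1 // => q qf; rewrite cfZ cf_mon.
by case: eqP => [e|_]; [rewrite -e map_f in nw | rewrite mulr0].
Qed.

Lemma eval_flatten (ss : seq (seq (K * seq 'I_3))) : eval (flatten ss) = \sum_(s <- ss) eval s.
Proof.
by elim: ss => [|s ss IH]; rewrite /eval ?big_nil //= big_cat big_cons -IH.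
Qed.

Lemma eval_pmul f g : eval (pmul f g) = eval f * eval g.
Proof.
rewrite eval_flatten big_map /eval mulr_suml; apply: eq_bigr => q _.
rewrite big_map mulr_sumr; apply: eq_bigr => r _ /=.
by rewrite monM -scalerAl fa_scalerAr scalerA.
Qed.

Lemma eval_pletter v c l : eval (pletter v c l) = stepx A v c (var A l).
Proof.
rewrite /stepx /tri_sub /= sub_var /pletter /eval; case: (letterP l) => -> /=.
- by rewrite big_cons big_seq1.
- by rewrite big_seq1 addr0.
- by rewrite big_seq1 scale1r.
Qed.

Lemma eval_pstep v c f : eval (pstep v c f) = stepx A v c (eval f).
Proof.
rewrite eval_flatten big_map [in RHS]/eval linear_sum; apply: eq_bigr => q _.
rewrite linearZ /=; case: q => a w /=; elim: w => [|l w IH] /=.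
  by rewrite /eval big_seq1 mon1 rmorph1.
by rewrite eval_pmul IH mon_cons rmorphM /= eval_pletter fa_scalerAr.
Qed.

Lemma eval_pswap f : eval (pswap f) = swap_xy A (eval f).
Proof.
rewrite /eval big_map linear_sum; apply: eq_bigr => q _.
by rewrite linearZ /= swap_xy_mon.
Qed.

Lemma plessP g f : reflect (less (eval g) (eval f)) (pless g f).
Proof.
apply: (iffP hasP) => [[u uf /allP ug]|[u uf ug]].
  by exists u => [|u' gu']; [rewrite -mem_psupp | apply: ug; rewrite mem_psupp].
by exists u; [rewrite mem_psupp | apply/allP => u'; rewrite mem_psupp; apply: ug].
Qed.

Lemma no_xP v : reflect (nx v = 0%N) (all (fun l => l != lx) v).
Proof.
rewrite (@eq_all _ _ (predC (pred1 lx))) // all_predC has_pred1 nx_mem -eqn0Ngt.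
exact: eqP.
Qed.

Lemma mem_candidates f v c : good_step (eval f) v c -> (v, c) \in candidates f.
Proof.
case=> w [u [s [t [xv fw fu eu ec]]]]; apply/flatten_mapP; exists w; first by rewrite mem_psupp.
apply/flatten_mapP; exists u; first by rewrite mem_psupp.
rewrite ec !cf_eval; apply: (map_f (fun v => (v, _))); rewrite mem_filter; apply/andP; split.
  exact/no_xP.
by rewrite eu; apply: mem_factors.
Qed.

Lemma candidates_nx f v c : (v, c) \in candidates f -> nx v = 0%N.
Proof.
case/flatten_mapP => w _ /flatten_mapP[u _ /mapP[v']].
by rewrite mem_filter => /andP[/no_xP xv _] [-> _].
Qed.

Lemma nexts_sound f g : g \in nexts f -> less (eval g) (eval f) /\
  exists v c, nx v = 0%N /\
    (eval g = stepx A v c (eval f) \/ eval g = swap_xy A (stepx A v c (swap_xy A (eval f)))).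
Proof.
rewrite mem_filter mem_cat => /andP[/plessP lt h]; split=> //.
case/orP: h => [/mapP[[v c] /candidates_nx xv ->]|/mapP[_ /mapP[[v c] /candidates_nx xv ->] ->]].
  by exists v, c; split=> //; left; rewrite eval_pstep.
by exists v, c; split=> //; right; rewrite eval_pswap eval_pstep eval_pswap.
Qed.

Lemma nexts_complete f : omega (eval f) -> nexts f = [::] -> terminal (eval f).
Proof.
move=> om no; have {}no g : g \notin nexts f by rewrite no.
case: (omega_reduce om) => [//|[v [c [gs lt]]]|[v [c [gs lt]]]].
  case/negP: (no (pstep v c f)); rewrite mem_filter; apply/andP; split.
    by apply/plessP; rewrite eval_pstep.
  by rewrite mem_cat (map_f (fun q => pstep q.1 q.2 f) (mem_candidates gs)).
rewrite -eval_pswap in gs lt.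
case/negP: (no (pswap (pstep v c (pswap f)))); rewrite mem_filter; apply/andP; split.
  by apply/plessP; rewrite eval_pswap eval_pstep.
rewrite mem_cat; apply/orP; right; apply: map_f.
exact: (map_f (fun q => pstep q.1 q.2 (pswap f)) (mem_candidates gs)).
Qed.

(** Induction on a word that bounds all words of g: whatever is below g is bounded by a word of g,
    which is smaller. *)
Lemma less_wf g : Acc (fun g f => less (eval g) (eval f)) g.
Proof.
have H u : forall g', (forall u', cf (eval g') u' != 0 -> wlt u' u) ->
    Acc (fun g f => less (eval g) (eval f)) g'.
  elim: u / (wlt_wf u) => u _ IH g' g'u; constructor=> h [u1 gu1 hu1].
  exact: IH (g'u _ gu1) _ hu1.
by constructor=> h [u _]; apply: H.
Qed.

Lemma only_zP w : all (fun l => ~~ (l == lx) && ~~ (l == ly)) w = (nx w == 0%N) && (ny w == 0%N).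
Proof. by elim: w => //= l w ->; rewrite !nE; case: (letterP l) => -> //=; rewrite andbF. Qed.

Lemma pterminalP f : reflect (terminal (eval f)) (pterminal f).
Proof.
apply: (iffP andP) => [[/allP h /hasP[w fw ew]]|[al [be [b [ab bz e]]]]].
  rewrite mem_psupp in fw; pose b := eval f - (cf (eval f) [:: lx] *: var A lx + cf (eval f)
    [:: ly] *: var A ly).
  exists (cf (eval f) [:: lx]), (cf (eval f) [:: ly]), b; split.
  - by case/orP: ew => /eqP ew; rewrite -ew fw ?orbT.
  - move=> s; rewrite cfB cfD !cfZ !cf_var; case: (s =P [:: lx]) => [->|nx_s].
      by rewrite mulr1 mulr0 addr0 subrr eqxx.
    case: (s =P [:: ly]) => [->|ny_s]; first by rewrite mulr1 mulr0 add0r subrr eqxx.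
    rewrite !mulr0 addr0 subr0 -mem_psupp => /h /or3P[/eqP//|/eqP//|].
    by rewrite only_zP => /andP[/eqP-> /eqP->].
  - by rewrite /b addrC subrK.
have cfe s : cf (eval f) s = al * (s == [:: lx])%:R + be * (s == [:: ly])%:R + cf b s.
  by rewrite e !cfD !cfZ !cf_var.
have b0 s : (nx s != 0%N) || (ny s != 0%N) -> cf b s = 0.
  by apply: contraTeq => /bz[-> ->].
split; last first.
  apply/hasP; case/orP: ab => [a0|a0]; [exists [:: lx] | exists [:: ly]] => //;
    by rewrite mem_psupp cfe b0 //= mulr1 mulr0 ?addr0 ?add0r.
apply/allP => s; rewrite mem_psupp cfe only_zP; case: (s == [:: lx]) => //.
case: (s == [:: ly]) => //; rewrite !mulr0 !add0r => /bz[-> ->]; by rewrite eqxx.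
Qed.

(** The last clause speaks of any property invariant under steps and the swap, so it does not matter
    which lowering candidate the loop picks. *)
Lemma iterates_nexts f : exists h, [/\ nexts h = [::],
  iterates (fun f => ~~ nilp (nexts f)) (fun f => head f (nexts f)) f h &
  forall P : A -> Prop, (forall v c a, nx v = 0%N -> (P (stepx A v c a) <-> P a)) ->
    (forall a, P (swap_xy A a) <-> P a) -> P (eval h) <-> P (eval f)].
Proof.
elim: f / (less_wf f) => f _ IH.
case en: (nexts f) => [|g s].
  by exists f; split=> //; apply: iterates_stop; rewrite en.
have gn : g \in nexts f by rewrite en inE eqxx.
have [lt [v [c [xv eg]]]] := nexts_sound gn.
have [h [hn it hP]] := IH g lt; exists h; split=> //.
  by apply: iterates_step; rewrite en.
move=> P Pstep Pswap; rewrite (hP P Pstep Pswap).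
by case: eg => ->; rewrite ?Pswap Pstep ?Pswap.
Qed.

End Semantics.
End Algorithm.

(** * Programs on words and their order *)

Section WordComputability.
Context {G : Type} {cG : coded G}.
Implicit Types u w : G -> seq 'I_3.

Lemma comp_nx u : computable u -> computable (fun x => nx (u x)).
Proof.
move=> hu; apply: (comp_ext (f := fun x => foldr (fun l n =>
  if l == lx then n.+1 else n) 0%N (u x))).
  by move=> x; elim: (u x) => //= l s ->; rewrite nx_cons; case: eqP.
apply: comp_foldr comp_nat0 hu; apply: comp_if; [apply: comp_is_x | apply: comp_S |]; comp_proj.
Qed.

Lemma comp_ny u : computable u -> computable (fun x => ny (u x)).
Proof.
move=> hu; apply: (comp_ext (f := fun x => foldr (fun l n =>
  if l == ly then n.+1 else n) 0%N (u x))).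
  by move=> x; elim: (u x) => //= l s ->; rewrite ny_cons; case: eqP.
apply: comp_foldr comp_nat0 hu; apply: comp_if; [apply: comp_is_y | apply: comp_S |]; comp_proj.
Qed.

Lemma comp_nz u : computable u -> computable (fun x => nz (u x)).
Proof.
move=> hu; apply: (comp_ext (f := fun x =>
  foldr (fun l n => if l == lx then n else if l == ly then n else n.+1) 0%N (u x))).
  by move=> x; elim: (u x) => //= l s ->; rewrite nz_cons; case: (letterP l) => ->.
apply: comp_foldr comp_nat0 hu; apply: comp_if; [apply: comp_is_x | | apply: comp_if;
  [apply: comp_is_y | | apply: comp_S]]; comp_proj.
Qed.

Lemma comp_val3 u : computable u -> computable (fun x => val3 (u x)).
Proof.
(* The product by 3 is written as a sum, for which [comp_addn] is at hand. *)
move=> hu; apply: (comp_ext (f := fun x => foldl (fun n l => n + n + n +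
    (if l == ly then 2 else if l == lx then 1 else 0))%N 0%N (u x))).
  move=> x; rewrite /val3; elim/last_ind: (u x) => // s l IH;
    rewrite !foldl_rcons IH -/(digit l); lia.
apply: comp_foldl comp_nat0 hu.
have hn : computable (fun q : G * nat * 'I_3 => q.1.2) by comp_proj.
have hl : computable (fun q : G * nat * 'I_3 => q.2) by comp_proj.
apply: comp_addn; first exact: comp_addn (comp_addn hn hn) hn.
have c0 : computable (fun _ : G * nat * 'I_3 => 0%N) by exact: comp_nat0.
apply: comp_if; [exact: comp_is_y | exact: (comp_S (comp_S c0)) |].
by apply: comp_if; [exact: comp_is_x | exact: (comp_S c0) | exact: c0].
Qed.

Lemma comp_wlt u w : computable u -> computable w -> computable (fun x => wlt (u x) (w x)).
Proof.
move=> hu hw; apply: (comp_ext (f := fun x => wtlt (u x) (w x) ||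
    (wteq (u x) (w x) && (val3 (u x) < val3 (w x))%N))).
  move=> x; rewrite /wlt; congr orb; case e: (wteq _ _) => //=.
  by rewrite lexlt_val3 //; apply: wteq_size.
have xu := comp_nx hu; have yu := comp_ny hu; have zu := comp_nz hu.
have xw := comp_nx hw; have yw := comp_ny hw; have zw := comp_nz hw.
have du := comp_addn xu yu; have dw := comp_addn xw yw.
apply: comp_or; last apply: comp_and.
- apply: comp_or; first exact: comp_leq (comp_S du) dw.
  exact: comp_and (comp_eqn du dw) (comp_leq (comp_S zu) zw).
- exact: comp_and (comp_eqn du dw) (comp_eqn zu zw).
- exact: comp_leq (comp_S (comp_val3 hu)) (comp_val3 hw).
Qed.

(** By totality of the order, two words are equal when neither is below the other. *)
Lemma comp_eqw u w : computable u -> computable w -> computable (fun x => u x == w x).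
Proof.
move=> hu hw; apply: (comp_ext (f := fun x => ~~ wlt (u x) (w x) && ~~ wlt (w x) (u x))).
  move=> x; case: eqP => [->|ne]; first by rewrite wlt_irr.
  by case: (wlt_total (u x) (w x)) => // ->; rewrite ?andbF.
by apply: comp_and; apply: comp_not; apply: comp_wlt.
Qed.

End WordComputability.

Lemma comp_tails : computable tails.
Proof.
apply: (comp_foldl (F := fun _ acc l => [::] :: [seq rcons t l | t <- acc])
  (b := fun _ => [:: [::]]) (s := fun u => u)).
- apply: comp_cons comp_nil _.
  apply: (comp_map (F := fun q (t : seq 'I_3) => rcons t q.2)); last by comp_proj.
  apply: (comp_ext (f := fun q => q.2 ++ [:: q.1.2])); first by move=> q; rewrite cats1.
  by apply: comp_cat; [comp_proj | apply: comp_cons comp_nil; comp_proj].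
- exact: comp_cons comp_nil comp_nil.
- exact: comp_id.
Qed.

Lemma comp_factors : computable factors.
Proof.
apply: comp_flatten; apply: (comp_map (F := fun _ t => [seq rev s | s <- tails (rev t)])).
  apply: (comp_map (F := fun _ s => rev s)); first by apply: comp_rev; comp_proj.
  by apply: (comp_comp comp_tails); apply: comp_rev; comp_proj.
exact: comp_tails.
Qed.

Lemma comp_swap_letter : computable swap_letter.
Proof.
by apply: comp_if; [apply: comp_is_x comp_id | apply: comp_letter |
  apply: comp_if (comp_is_y comp_id) (comp_letter _) (comp_letter _)].
Qed.

(** * Programs on polynomials over a constructive field *)

Section FieldComputability.
Variables (K : fieldType) (nu : tree -> option K).
Hypothesis nuK : constructive_field nu.

#[local] Instance coded_field : coded K := fun t a => nu t = Some a.

Section Operations.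
Context {G : Type} {cG : coded G}.
Implicit Types f g : G -> K.

Lemma comp_cstK (a : K) : computable (fun _ : G => a).
Proof. by apply: comp_cst; apply: nu_surj nuK a. Qed.

Lemma comp_addK f g : computable f -> computable g -> computable (fun x => f x + g x).
Proof.
move=> hf hg; apply: (comp_comp (g := fun q : K * K => q.1 + q.2)) (comp_pair hf hg).
have [p hp] := nu_add nuK; exists p => -[|t1 t2] [a b] //= [h1 h2]; exact: hp.
Qed.

Lemma comp_mulK f g : computable f -> computable g -> computable (fun x => f x * g x).
Proof.
move=> hf hg; apply: (comp_comp (g := fun q : K * K => q.1 * q.2)) (comp_pair hf hg).
have [p hp] := nu_mul nuK; exists p => -[|t1 t2] [a b] //= [h1 h2]; exact: hp.
Qed.

Lemma comp_oppK f : computable f -> computable (fun x => - f x).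
Proof. by move=> hf; apply: comp_comp hf; apply: nu_opp nuK. Qed.

Lemma comp_eqK f g : computable f -> computable g -> computable (fun x => f x == g x).
Proof.
move=> hf hg; apply: (comp_comp (g := fun q : K * K => q.1 == q.2)) (comp_pair hf hg).
have [p hp] := nu_eq nuK; exists p => -[|t1 t2] [a b] //= [h1 h2].
by exists (tree_of_bool (a == b)) => //; apply: hp.
Qed.

End Operations.

(** The given program may diverge on codes of 0, so 0 is tested first and answered by 0, in
    agreement with [invr0]. *)
Lemma comp_invK : computable (fun a : K => a^-1).
Proof.
have [p hp] := nu_inv nuK.
have c0 : computable (fun _ : K => 0 : K) by exact: comp_cstK.
have [p0 hp0] := c0; have [pe hpe] := comp_eqK comp_id c0.
exists (PIf pe p0 p) => t a ta; have [u r eu] := hpe _ _ ta; rewrite eu {u eu} in r.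
case: (eqVneq a 0) r => [a0|a0] r.
  have [v r0 hv] := hp0 _ _ ta; exists v; first exact: run_if_true r r0.
  by rewrite a0 invr0.
have [v r0 hv] := hp _ _ ta a0; exists v => //; exact: run_if_false r r0.
Qed.

Lemma comp_divK G (cG : coded G) (f g : G -> K) :
  computable f -> computable g -> computable (fun x => f x / g x).
Proof. by move=> hf hg; apply: comp_mulK hf (comp_comp comp_invK hg). Qed.

Local Notation poly := (seq (K * seq 'I_3)).

Lemma comp_pcoef : computable (fun q : poly * seq 'I_3 => pcoef q.1 q.2).
Proof.
apply: (comp_foldl (F := fun q s r => if r.2 == q.2 then s + r.1 else s)); last by comp_proj.
  apply: comp_if; [apply: comp_eqw | apply: comp_addK |]; comp_proj.
exact: comp_cstK.
Qed.

Lemma comp_psupp : computable (fun f : poly => psupp f).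
Proof.
apply: (comp_filter (P := fun f w => pcoef f w != 0)).
  by apply: comp_not; apply: comp_eqK comp_pcoef (comp_cstK _).
by apply: (comp_map (F := fun _ q => q.2)); comp_proj.
Qed.

Lemma comp_pmul : computable (fun q : poly * poly => pmul q.1 q.2).
Proof.
apply: comp_flatten; apply: (comp_map (F := fun q r => [seq (r.1 * r'.1,
  r.2 ++ r'.2) | r' <- q.2]));
  last by comp_proj.
apply: (comp_map (F := fun q r' => (q.2.1 * r'.1, q.2.2 ++ r'.2))); last by comp_proj.
by apply: comp_pair; [apply: comp_mulK | apply: comp_cat]; comp_proj.
Qed.

Lemma comp_pletter : computable (fun q : seq 'I_3 * K * 'I_3 => pletter q.1.1 q.1.2 q.2).
Proof.
have c1 : computable (fun _ : seq 'I_3 * K * 'I_3 => 1 : K) by exact: comp_cstK.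
apply: comp_if; first by apply: comp_is_x; comp_proj.
  apply: comp_cons; first by apply: comp_pair c1 (comp_cons (comp_letter _) comp_nil).
  by apply: comp_cons comp_nil; apply: comp_pair; [apply: comp_oppK |]; comp_proj.
by apply: comp_cons comp_nil; apply: comp_pair c1 (comp_cons _ comp_nil); comp_proj.
Qed.

Lemma comp_pstep : computable (fun q : seq 'I_3 * K * poly => pstep q.1.1 q.1.2 q.2).
Proof.
apply: comp_flatten; apply: (comp_map (F := fun q r =>
  foldr (fun l acc => pmul (pletter q.1.1 q.1.2 l) acc) [:: (r.1, [::])] r.2)); last by comp_proj.
apply: (comp_foldr (F := fun q l acc => pmul (pletter q.1.1.1 q.1.1.2 l) acc)); last by comp_proj.
  apply: (comp_app2 comp_pmul); last by comp_proj.
  by apply: (comp_app3 comp_pletter); comp_proj.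
by apply: comp_cons comp_nil; apply: comp_pair comp_nil; comp_proj.
Qed.

Lemma comp_pswap : computable (fun f : poly => pswap f).
Proof.
apply: (comp_map (F := fun _ q => (q.1, swap_word q.2))); last by comp_proj.
apply: comp_pair; first by comp_proj.
apply: (comp_map (F := fun _ l => swap_letter l)); last by comp_proj.
by apply: (comp_comp comp_swap_letter); comp_proj.
Qed.

Lemma comp_candidates : computable (fun f : poly => candidates f).
Proof.
apply: comp_flatten; apply: (comp_map (F := fun f w => flatten [seq
    [seq (v, pcoef f u / pcoef f w) | v <- factors u & all (fun l => l != lx) v]
  | u <- psupp f])); last exact: comp_psupp.
apply: comp_flatten; apply: (comp_map (F := fun q u =>
    [seq (v, pcoef q.1 u / pcoef q.1 q.2) | v <- factors u & all (fun l => l != lx) v])).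
  apply: (comp_map (F := fun q v => (v, pcoef q.1.1 q.2 / pcoef q.1.1 q.1.2))).
    apply: comp_pair; first by comp_proj.
    by apply: comp_divK; apply: (comp_app2 comp_pcoef); comp_proj.
  apply: (comp_filter (P := fun _ v => all (fun l => l != lx) v)).
    apply: (comp_all (P := fun _ l => l != lx)); last by comp_proj.
    by apply: comp_not; apply: comp_is_x; comp_proj.
  by apply: (comp_comp comp_factors); comp_proj.
by apply: (comp_comp comp_psupp); comp_proj.
Qed.

Lemma comp_pless : computable (fun q : poly * poly => pless q.1 q.2).
Proof.
apply: (comp_has (P := fun q u => all (fun u' => wlt u' u) (psupp q.1))).
  apply: (comp_all (P := fun q u' => wlt u' q.2)); first by apply: comp_wlt; comp_proj.
  by apply: (comp_comp comp_psupp); comp_proj.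
by apply: (comp_comp comp_psupp); comp_proj.
Qed.

Lemma comp_xsteps : computable (fun f : poly => xsteps f).
Proof.
apply: (comp_map (F := fun f q => pstep q.1 q.2 f)); last exact: comp_candidates.
by apply: (comp_app3 comp_pstep); comp_proj.
Qed.

Lemma comp_nexts : computable (fun f : poly => nexts f).
Proof.
apply: (comp_filter (P := fun f g => pless g f)).
  by apply: (comp_app2 comp_pless); comp_proj.
apply: comp_cat comp_xsteps _; apply: (comp_map (F := fun _ g => pswap g)).
  by apply: (comp_comp comp_pswap); comp_proj.
exact: (comp_comp comp_xsteps comp_pswap).
Qed.

Lemma comp_pterminal : computable (fun f : poly => pterminal f).
Proof.
have single l : computable (fun q : poly * seq 'I_3 => q.2 == [:: l]).
  by apply: comp_eqw; [comp_proj | apply: comp_cons (comp_letter _) comp_nil].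
apply: comp_and.
  apply: (comp_all (P := fun _ w => [|| w == [:: lx], w == [:: ly] |
    all (fun l => ~~ (l == lx) && ~~ (l == ly)) w])); last exact: comp_psupp.
  apply: comp_or (single lx) (comp_or (single ly) _).
  apply: (comp_all (P := fun _ l => ~~ (l == lx) && ~~ (l == ly))); last by comp_proj.
  by apply: comp_and; apply: comp_not; [apply: comp_is_x | apply: comp_is_y]; comp_proj.
apply: (comp_has (P := fun _ w => (w == [:: lx]) || (w == [:: ly]))); last exact: comp_psupp.
exact: comp_or (single lx) (single ly).
Qed.

Lemma word_of_tree_code t w : word_of_tree t = Some w -> code t (w : seq 'I_3).
Proof.
elim: t w => [|l _ t IH] w /=; first by case=> <-; rewrite fm1.
case el: (letter_of_tree l) => [i|] //; case ew: (word_of_tree t) => [v|] // [<-].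
by rewrite fmM fmU /=; split; [exact: el | exact: IH].
Qed.

(** A valid input tree is already a code of a list of pairs, so no translation program is run. *)
Lemma poly_of_tree_code t f : poly_of_tree nu t = Some f ->
  exists2 s : poly, code t s & eval (free_word_algebra K) s = f.
Proof.
elim: t f => [|t1 _ t IH] f /=; first by case=> <-; exists [::] => //; rewrite /eval big_nil.
case: t1 => [|c m] //; case ec: (nu c) => [a|] //.
case em: (word_of_tree m) => [w|] //; case eg: (poly_of_tree nu t) => [g|] // [<-].
have [s ts <-] := IH _ eg; exists ((a, (w : seq 'I_3)) :: s).
  by split=> //; split; [exact: ec | exact: word_of_tree_code].
by rewrite /eval big_cons /= /free_mon fmK.
Qed.

End FieldComputability.

Theorem theorem2p5 (K : fieldType) (nu : tree -> option K)
    (K_constructive : constructive_field nu) :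
  exists p : prog, decides_poly nu p (@z_tame_coordinate K).
Proof.
pose cK := coded_field nu.
have cn := comp_nexts K_constructive.
have [pt ht] := comp_pterminal K_constructive.
have [pw hw] := comp_while (comp_not (comp_nilp cn)) (comp_head comp_id cn).
exists (PComp pt pw) => t f /poly_of_tree_code[s ts <-].
have [h [hn it inv]] := iterates_nexts (free_word_algebra K) s.
have [u r1 uh] := hw _ _ _ ts it; have [b r2 eb] := ht _ _ uh.
have {}inv := inv (@z_tame_coordinate K).
have coord : z_tame_coordinate (eval (free_word_algebra K) h) <->
    z_tame_coordinate (eval (free_word_algebra K) s).
  (* Steps and swap are tame with tame inverses, so the loop changes nothing about being a
     coordinate. *)
  apply: inv => [v c a xv|a]; last exact: (coordinate_tame a (tame_swap_xy K) (tame_swap_xy K)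
    (@swap_xyK K (free_word_algebra K))).
  have ts' : is_tri (stepx (free_word_algebra K) v c).
    by do 4 eexists; apply: stepxP.
  have [psi [tpsi K1 _]] := tri_inv ts'.
  exact: (coordinate_tame a (tame_tri ts') (tame_tri tpsi) K1).
(* No step is left at h. If h is a coordinate, it lies in the orbit and must be terminal; conversely
   a terminal element is a coordinate. *)
have dec : pterminal h <-> z_tame_coordinate (eval (free_word_algebra K) s).
  rewrite -coord; split=> [/(pterminalP (free_word_algebra K))|/coordinate_omega om].
    exact: terminal_coordinate.
  exact/(pterminalP (free_word_algebra K))/nexts_complete.
have r : run (PComp pt pw) t (tree_of_bool (pterminal h)) by rewrite -eb; apply: run_comp r1 r2.
split=> [/dec e|ne]; first by rewrite e in r.
by case: (pterminal h) dec r => // dec _; case: ne; apply/dec.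
Qed.
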